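(* Let $n\ge1$, let $l_1,\ldots,l_n>0$, let $e_1,\ldots,e_n$ be the standard orthonormal basis of $\mathbb R^n$, and let $S=\mathrm{conv}[l_1e_1,\ldots,l_ne_n]$. For every $1\le m\le n$, the $(m-1)$-st intrinsic volume of $S$ is $$V_{m-1}(S)=\frac{1}{(m-1)!}\sum_{1\le i_1<\ldots<i_m\le n}\left\{l_{i_1}\cdots l_{i_m}\left(\frac1{l_{i_1}^2}+\ldots+\frac1{l_{i_m}^2}\right)\int_{\mathbb R}\varphi\left(x\sqrt{\frac1{l_{i_1}^2}+\ldots+\frac1{l_{i_m}^2}}\right)\prod_{i\notin\{i_1,\ldots,i_m\}}\Phi\left(\frac x{l_i}\right)\mathrm dx\right\},$$ where the product is over $i\in\{1,\ldots,n\}\setminus\{i_1,\ldots,i_m\}$.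
   Context: $\mathrm{conv}$ denotes the convex hull. For a compact convex set $T\subset\mathbb R^n$ the intrinsic volumes $V_0(T),\ldots,V_n(T)$ are defined by the Steiner formula $\mathrm{Vol}_n(T+r\mathbb B_n)=\sum_{k=0}^n\kappa_{n-k}V_k(T)r^{n-k}$ for all $r\ge0$, where $\mathbb B_n$ is the unit ball of $\mathbb R^n$ and $\kappa_k=\pi^{k/2}/\Gamma(\frac k2+1)$. $\varphi(t)=\frac{1}{\sqrt{2\pi}}e^{-t^2/2}$ and $\Phi(t)=\int_{-\infty}^t\varphi(s)\,\mathrm ds$ are the standard normal density and distribution function. *)

(* Defs.v *)
From HB Require Import structures.
From mathcomp Require Import all_boot all_order all_algebra.
From mathcomp Require Import all_classical all_reals all_analysis.
From mathcomp Require Import measurable_realfun.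

Set Implicit Arguments.
Unset Strict Implicit.
Unset Printing Implicit Defensive.

Import Order.TTheory GRing.Theory Num.Theory.
Import numFieldNormedType.Exports.

Local Open Scope classical_set_scope.
Local Open Scope ring_scope.

(* n-fold product of the one-dimensional Lebesgue measure, transported along
   (x, t) |-> x :: t to n-tuples. *)
Fixpoint lebesgue_tuple (R : realType) (n : nat) :
    set (n.-tuple (measurableTypeR R)) -> \bar R :=
  match n with
  | 0 => \d_([tuple] : 0.-tuple (measurableTypeR R))
  | n'.+1 => pushforward (lebesgue_measure \x @lebesgue_tuple R n')%E
               (fun p : measurableTypeR R * n'.-tuple (measurableTypeR R) =>
                  [tuple of p.1 :: p.2])
  end.

Definition Vol (R : realType) (n : nat) (A : set 'rV[R]_n) : \bar R :=
  @lebesgue_tuple R n [set t | A (\row_i tnth t i)].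

Definition conv_hull (R : realType) (n : nat) (A : set 'rV[R]_n) :
    set 'rV[R]_n :=
  smallest (@convex_set R 'rV[R]_n) A.

(* The library's norm on 'rV[R]_n is the sup norm, hence an explicit Euclidean
   ball. *)
Definition unit_ball (R : realType) (n : nat) : set 'rV[R]_n :=
  [set x | Num.sqrt (\sum_(i < n) x ord0 i ^+ 2) <= 1].

Definition minkowski_sum (R : realType) (n : nat) (A B : set 'rV[R]_n) :
    set 'rV[R]_n :=
  [set x + y | x in A & y in B].

Definition dilate (R : realType) (n : nat) (r : R) (A : set 'rV[R]_n) :
    set 'rV[R]_n :=
  [set r *: x | x in A].

Definition Gamma (R : realType) (s : R) : R :=
  \int[lebesgue_measure]_(t in `]0, +oo[) (t `^ (s - 1) * expR (- t)).

Definition kappa (R : realType) (k : nat) : R :=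
  pi `^ (k%:R / 2) / Gamma (k%:R / 2 + 1).
Arguments kappa : clear implicits.

Definition steiner_formula (R : realType) (n : nat) (T : set 'rV[R]_n)
    (V : 'I_n.+1 -> R) : Prop :=
  forall r : R, 0 <= r ->
    Vol (minkowski_sum T (dilate r (@unit_ball R n))) =
    (\sum_(k < n.+1) kappa R (n - k) * V k * r ^+ (n - k))%:E.

(* V_k(T), 0 <= k <= n: the k-th of the coefficients for which the Steiner
   formula of T holds; they are unique (steiner_formula_unique below) and exist
   for T compact convex.  Otherwise the value is irrelevant. *)
Definition intrinsic_volume (R : realType) (n : nat) (T : set 'rV[R]_n)
    (k : nat) : R :=
  xget (fun=> 0) [set V | @steiner_formula R n T V] (inord k).

Definition phi (R : realType) (t : R) : R :=
  (Num.sqrt (2 * pi))^-1 * expR (- t ^+ 2 / 2).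

Definition Phi (R : realType) (t : R) : R :=
  \int[lebesgue_measure]_(s in `]-oo, t]) phi s.

Lemma phiE (R : realType) : @phi R = normal_pdf 0 1.
Proof.
apply/funext => t; rewrite normal_pdfE ?oner_neq0// /phi.
by rewrite /normal_peak /normal_fun subr0 expr1n mul1r mulr_natl.
Qed.

Lemma lebesgue_tuple0 (R : realType) (n : nat) : @lebesgue_tuple R n set0 = 0%E.
Proof.
elim: n => [|n IH] /=; first by rewrite dirac0.
rewrite /pushforward preimage_set0 /product_measure1.
by rewrite integral0_eq// => x _ /=; rewrite xsection0.
Qed.

Lemma Vol_box (R : realType) (n : nat) (a b : 'I_n -> R) :
  (forall i, a i <= b i) ->
  Vol [set x : 'rV[R]_n | forall i, a i <= x ord0 i <= b i] =
  (\prod_(i < n) (b i - a i))%:E.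
Proof.
rewrite /Vol; elim: n a b => [|n IH] a b ab.
  by rewrite big_ord0 /= diracE mem_set//=; case.
rewrite big_ord_recl /= /pushforward /product_measure1 /=.
set B := \prod_(i < n) _.
have B0 : 0 <= B by apply: prodr_ge0 => i _; rewrite subr_ge0.
transitivity (\int[@lebesgue_measure R]_x ((\1_(`[a ord0, b ord0]%classic : set R) x)%:E * B%:E))%E.
  apply: eq_integral => x _ /=; rewrite indicE.
  set A := xsection _ _.
  have AE t : A t <-> x \in `[a ord0, b ord0] /\
      (forall i, a (lift ord0 i) <= tnth t i <= b (lift ord0 i)).
    rewrite /A /xsection /= inE /=; split.
      move=> h; split.
        by move: (h ord0); rewrite mxE tnth0 in_itv.
      by move=> i; move: (h (lift ord0 i)); rewrite mxE tnthS.
    move=> [h1 h2] i; rewrite mxE.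
    have [->|[j ->]] : i = ord0 \/ exists j, i = lift ord0 j.
      by case: (unliftP ord0 i) => [j ->|->]; [right; exists j|left].
      by move: h1; rewrite tnth0 in_itv.
    by rewrite tnthS.
  have [xab|xab] := boolP (x \in `[a ord0, b ord0]%classic).
    rewrite mul1e /B -IH//; congr lebesgue_tuple.
    apply/seteqP; split => t /=.
      by move=> /AE[_ h] i; rewrite mxE.
    move=> h; apply/AE; split; first by move: xab; rewrite inE.
    by move=> i; move: (h i); rewrite mxE.
  rewrite mul0e (_ : A = set0) ?lebesgue_tuple0//.
  apply/seteqP; split => t //= /AE[h _]; move: xab; rewrite notin_setE.
  exact.
rewrite ge0_integralZr//; last first.
  by apply/measurable_EFinP; exact: measurable_indic.
rewrite integral_indic// setIT.
transitivity ((lebesgue_measure (`[a ord0, b ord0]%classic : set R)) * B%:E)%E.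
  by [].
rewrite lebesgue_measure_itv/= lte_fin.
have := ab ord0; rewrite le_eqVlt => /orP[/eqP ->|->].
  by rewrite ltxx subrr mul0r mul0e.
by rewrite -EFinB -EFinM.
Qed.

Lemma Gamma_gt0 (R : realType) (s : R) : 1 <= s -> 0 < Gamma s.
Proof.
move=> s1; pose f (t : R) := t `^ (s - 1) * expR (- t).
have f0 t : 0 <= f t by rewrite mulr_ge0 ?powR_ge0 ?expR_ge0.
have mf D : measurable D -> measurable_fun D (EFin \o f).
  move=> mD; apply/measurable_EFinP; apply: measurable_funTS.
  apply: measurable_funM; first exact: measurable_powR.
  by apply: measurableT_comp => //; exact: measurable_oppr.
rewrite /Gamma /Rintegral fine_gt0//; apply/andP; split.
  apply: (@lt_le_trans _ _
      (\int[@lebesgue_measure R]_(t in `[1%R, 2%R]) (f t)%:E)%E); last first.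
    apply: ge0_subset_integral => //.
    - exact: mf.
    - by move=> t _; rewrite lee_fin.
    - move=> t /=; rewrite !in_itv/= andbT => /andP[t1 _].
      exact: lt_le_trans t1.
  apply: (@lt_le_trans _ _
      (\int[@lebesgue_measure R]_(t in `[1%R, 2%R])
         (cst (expR (- 2))%:E t))%E); last first.
    apply: ge0_le_integral => //.
    - by move=> t _; rewrite lee_fin expR_ge0.
    - exact: mf.
    - move=> t /=; rewrite in_itv/= => /andP[t1 t2]; rewrite lee_fin /f.
      rewrite -[leLHS]mul1r ler_pM ?expR_ge0 ?ler_expR ?lerN2//.
      by rewrite -[leLHS](powRr0 t) ler_powR// subr_ge0.
  rewrite integral_cst// mule_gt0 ?lte_fin ?expR_gt0//.
  suff : (0 < lebesgue_measure (`[1%R, 2%R]%classic : set R))%E by [].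
  by rewrite lebesgue_measure_itv/= lte_fin ltr1n -EFinB lte_fin subr_gt0 ltr1n.
pose N := Num.truncn s; pose C : R := 1 + N.+1`!%:R * 2 ^+ N.+1.
have C0 : 0 <= C by rewrite addr_ge0// mulr_ge0// exprn_ge0.
apply: (@le_lt_trans _ _ (\int[@lebesgue_measure R]_(t in `]0%R, +oo[)
    ((C * 2)%:E * (exponential_pdf 2^-1 t)%:E))%E).
  apply: ge0_le_integral => //.
  - by move=> t _; rewrite lee_fin f0.
  - exact: mf.
  - apply/measurable_EFinP; apply: measurable_funTS.
    apply: measurable_funM => //; exact: measurable_exponential_pdf.
  - move=> t /=; rewrite in_itv/= andbT => t0; rewrite -EFinM lee_fin.
    rewrite exponential_pdfE ?(ltW t0)//=.
    rewrite [leRHS](_ : _ = C * expR (- 2^-1 * t)); last first.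
      by rewrite mulrA -(mulrA C) divff// mulr1.
    have E : expR (- t) = expR (- 2^-1 * t) * expR (- 2^-1 * t).
      by rewrite -expRD -mulrDl -opprD -{1 2}[2^-1]mul1r -splitr mulN1r.
    rewrite /f E mulrA ler_wpM2r ?expR_ge0//.
    rewrite mulNr expRN ler_pdivrMr ?expR_gt0//.
    have t20 : 0 <= 2^-1 * t by rewrite mulr_ge0 ?invr_ge0 ?(ltW t0).
    have := @expR_ge1Dxn R (2^-1 * t) N t20.
    set e := expR _ => he.
    have e1 : 1 <= e.
      by apply: le_trans he; rewrite lerDl divr_ge0// exprn_ge0.
    have te : t ^+ N.+1 <= N.+1`!%:R * 2 ^+ N.+1 * e.
      have /le_trans - /(_ _ he) : (2^-1 * t) ^+ N.+1 / N.+1`!%:R <=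
        1 + (2^-1 * t) ^+ N.+1 / N.+1`!%:R by rewrite lerDr.
      rewrite ler_pdivrMr ?ltr0n ?fact_gt0// exprMn exprVn.
      rewrite mulrC ler_pdivrMr ?exprn_gt0//.
      by rewrite -mulrA [e * _]mulrC.
    rewrite mulrDl mul1r; have [t1|t1] := leP t 1.
      apply: (@le_trans _ _ 1); last first.
        by rewrite -[leLHS]addr0 lerD// !mulr_ge0 ?exprn_ge0 ?expR_ge0.
      apply: (@le_trans _ _ (1 `^ (s - 1))); last by rewrite powR1.
      by rewrite ge0_ler_powR ?nnegrE ?subr_ge0// (ltW t0).
    apply: (@le_trans _ _ (t ^+ N.+1)).
      rewrite -powR_mulrn ?(ltW t0)// ler_powR ?(ltW t1)//.
      by rewrite lerBlDr (le_trans (ltW (truncnS_gt s)))// lerDl.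
    by apply: (le_trans te); rewrite lerDr ltW// (lt_le_trans _ e1).
rewrite ge0_integralZl//; last 3 first.
- apply/measurable_EFinP; apply: measurable_funTS.
  exact: measurable_exponential_pdf.
- by move=> t _; rewrite lee_fin exponential_pdf_ge0.
- by rewrite lee_fin mulr_ge0.
rewrite lte_mul_pinfty// ?lee_fin ?mulr_ge0//.
apply: (@le_lt_trans _ _ (\int[@lebesgue_measure R]_t (exponential_pdf 2^-1 t)%:E)%E).
  apply: ge0_subset_integral => //.
    by apply/measurable_EFinP; exact: measurable_exponential_pdf.
  by move=> t _; rewrite lee_fin exponential_pdf_ge0.
by rewrite integral_exponential_pdf// ltry.
Qed.

Lemma kappa_gt0 (R : realType) (k : nat) : 0 < kappa R k.
Proof.
by rewrite divr_gt0 ?powR_gt0 ?pi_gt0// Gamma_gt0// lerDr divr_ge0.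
Qed.

Lemma steiner_formula_unique (R : realType) (n : nat) (T : set 'rV[R]_n)
    (V W : 'I_n.+1 -> R) :
  steiner_formula T V -> steiner_formula T W -> V = W.
Proof.
move=> hV hW.
pose P (U : 'I_n.+1 -> R) : {poly R} :=
  \poly_(j < n.+1) (kappa R j * U (inord (n - j))).
have PE U r : (P U).[r] =
    \sum_(k < n.+1) kappa R (n - k) * U k * r ^+ (n - k).
  rewrite horner_poly (reindex_inj rev_ord_inj) /=; apply: eq_bigr => i _.
  by rewrite subSS subKn ?inord_val// -ltnS.
have PVW : P V = P W.
  apply/eqP; rewrite -subr_eq0; apply/eqP.
  pose rs := [seq k%:R : R | k <- iota 0 (size (P V - P W)).+1].
  apply: (@roots_geq_poly_eq0 _ _ rs).
  - apply/allP => _ /mapP[k _ ->]; rewrite /root hornerD hornerN !PE.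
    have k0 : 0 <= k%:R :> R by [].
    by have := hV _ k0; rewrite hW// => -[->]; rewrite subrr.
  - by rewrite map_inj_uniq ?iota_uniq//; apply: mulrIn; rewrite oner_eq0.
  - by rewrite size_map size_iota.
apply/funext => k; have /(congr1 (fun p : {poly R} => p`_(n - k))) := PVW.
rewrite !coef_poly ltnS leq_subr subKn ?inord_val; last by rewrite -ltnS.
by apply: mulfI; rewrite gt_eqF// kappa_gt0.
Qed.

(* Main.v *)
(* With a_i = 1 / l_i, S is the set of y >= 0 with sum_i a_i y_i = 1.  The point of S
   nearest to x is y_i = max(x_i - t a_i, 0), where t is the unique real making
   sum_i a_i y_i = 1; the face of S containing it in its relative interior is spanned by
   the set I of the i with x_i > t a_i, and the squared distance from x to S is
   t^2 (sum_(i in I) a_i^2) + sum_(i notin I) x_i^2.  So S + rB splits into one piece for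
   each nonempty I.  Replacing one coordinate x_i0, i0 in I, by t and integrating out the
   other coordinates in I, which then range over a translated simplex, leaves the volume
   of a ball of radius r intersected with the cone { x_i <= t a_i, i notin I } in
   the variables t and (x_i)_(i notin I), scaled in the variable t.  That volume is
   homogeneous in r, and integrating the layer-cake formula
   e^(-q/2) = int_(v >= q/2) e^(-v) dv over the cone identifies its constant with kappa
   times the Gaussian integral of the cone, which is the integral in the theorem. *)

From HB Require Import structures.
Require Import Defs.
From mathcomp Require Import all_boot all_order all_algebra.
From mathcomp Require Import all_classical all_reals all_analysis.
From mathcomp Require Import measurable_realfun ring lra.
Import Order.TTheory GRing.Theory Num.Theory.
Import numFieldNormedType.Exports.
Local Open Scope classical_set_scope.
Local Open Scope ring_scope.

Set Implicit Arguments.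
Unset Strict Implicit.
Unset Printing Implicit Defensive.

(** * Iterated integrals over coordinates *)

(** Integration overwrites a coordinate in place instead of removing it, so that all iterated
    integrals live on one tuple type and the order of integration is the order of a list of
    indices. *)
Definition upd (R : realType) (n : nat) (i : 'I_n) (t : measurableTypeR R)
    (x : n.-tuple (measurableTypeR R)) : n.-tuple (measurableTypeR R) :=
  [tuple if j == i then t else tnth x j | j < n].

Lemma tnth_upd (R : realType) n (i j : 'I_n) t (x : n.-tuple (measurableTypeR R)) :
  tnth (upd i t x) j = if j == i then t else tnth x j.
Proof. by rewrite tnth_mktuple. Qed.

Lemma upd_comm (R : realType) n (i j : 'I_n) s t (x : n.-tuple (measurableTypeR R)) :
  i != j -> upd i s (upd j t x) = upd j t (upd i s x).
Proof.
move=> ij; apply: eq_from_tnth => k; rewrite !tnth_upd.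
by have [->|//] := eqVneq k i; rewrite (negbTE ij).
Qed.

Lemma upd_upd (R : realType) n (i : 'I_n) s t (x : n.-tuple (measurableTypeR R)) :
  upd i s (upd i t x) = upd i s x.
Proof. by apply: eq_from_tnth => k; rewrite !tnth_upd; case: eqP. Qed.

Lemma measurable_upd (R : realType) n (i : 'I_n) :
  measurable_fun setT (fun p : measurableTypeR R * n.-tuple (measurableTypeR R) =>
    upd i p.1 p.2).
Proof.
apply/measurable_fun_tnthP => j /=.
rewrite (_ : _ \o _ = fun p => if j == i then p.1 else tnth p.2 j); last first.
  by apply/funext => p /=; rewrite tnth_upd.
case: (j == i); first exact: measurable_fst.
exact: (measurableT_comp (f := fun x => tnth x j) (measurable_tnth j) measurable_snd).
Qed.

(** The hypotheses of Tonelli's theorem, bundled because partial integration preserves them. *)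
Definition nnmeas d (T : measurableType d) (R : realType) (F : T -> \bar R) : Prop :=
  measurable_fun setT F /\ forall x, (0 <= F x)%E.

Lemma nnmeas_comp d d' (T : measurableType d) (T' : measurableType d')
    (R : realType) (F : T -> \bar R) (f : T' -> T) :
  nnmeas F -> measurable_fun setT f -> nnmeas (F \o f).
Proof. by move=> [mF F0] mf; split => //=; exact: measurableT_comp. Qed.

Lemma nnmeasM d (T : measurableType d) (R : realType) (F G : T -> \bar R) :
  nnmeas F -> nnmeas G -> nnmeas (fun x => F x * G x)%E.
Proof.
move=> [mF F0] [mG G0]; split; first exact: emeasurable_funM.
by move=> x; rewrite mule_ge0.
Qed.

Lemma nnmeas_fun_integral d (T : measurableType d) (R : realType)
    (F : measurableTypeR R * T -> \bar R) : nnmeas F ->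
  nnmeas (fun x => \int[lebesgue_measure]_t F (t, x))%E.
Proof.
move=> [mF F0]; split.
  exact: (@measurable_fun_fubini_tonelli_G _ _ _ _ _ (@lebesgue_measure R)).
by move=> x; exact: integral_ge0.
Qed.

Definition pint (R : realType) n (i : 'I_n)
    (F : n.-tuple (measurableTypeR R) -> \bar R) x : \bar R :=
  (\int[lebesgue_measure]_t F (upd i t x))%E.

(* The coordinates that are not in [s] keep their value in the argument. *)
Definition iint (R : realType) n (s : seq 'I_n)
    (F : n.-tuple (measurableTypeR R) -> \bar R) :=
  foldr (@pint R n) F s.

Lemma nnmeas_pint (R : realType) n (i : 'I_n)
    (F : n.-tuple (measurableTypeR R) -> \bar R) : nnmeas F -> nnmeas (pint i F).
Proof.
move=> mF; apply: (@nnmeas_fun_integral _ _ _ (fun p => F (upd i p.1 p.2))).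
by apply: (nnmeas_comp mF); exact: measurable_upd.
Qed.

Lemma nnmeas_iint (R : realType) n (s : seq 'I_n)
    (F : n.-tuple (measurableTypeR R) -> \bar R) : nnmeas F -> nnmeas (iint s F).
Proof. by move=> mF; elim: s => //= i s; exact: nnmeas_pint. Qed.

Lemma measurable_upd1 (R : realType) n (i : 'I_n) (x : n.-tuple (measurableTypeR R)) :
  measurable_fun setT (fun t => upd i t x).
Proof.
exact: (measurable_fun_pair1 x (measurable_upd i)).
Qed.

(** Tonelli's theorem on the plane through [x] in the directions [i] and [j]. *)
Lemma pint_comm (R : realType) n (i j : 'I_n)
    (F : n.-tuple (measurableTypeR R) -> \bar R) : nnmeas F ->
  pint i (pint j F) = pint j (pint i F).
Proof.
move=> mF; have [->//|ij] := eqVneq i j.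
apply/funext => x; rewrite /pint.
have mm : measurable_fun setT (fun p : measurableTypeR R * measurableTypeR R =>
    upd j p.2 (upd i p.1 x)).
  apply: (@measurableT_comp _ _ _ _ _ _ (fun p : measurableTypeR R * n.-tuple (measurableTypeR R) =>
    upd j p.1 p.2) _ (fun p : measurableTypeR R * measurableTypeR R => (p.2, upd i p.1 x))).
    exact: measurable_upd.
  apply: measurable_fun_pair; first exact: measurable_snd.
  exact: (measurableT_comp (measurable_upd1 i x) measurable_fst).
have [h1 h2] := nnmeas_comp mF mm.
rewrite (@fubini_tonelli _ _ _ _ _ lebesgue_measure lebesgue_measure _ h1 h2) /=.
by apply: eq_integral => t _; apply: eq_integral => u _; rewrite upd_comm 1?eq_sym.
Qed.

Lemma iint_cat (R : realType) n (s1 s2 : seq 'I_n)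
    (F : n.-tuple (measurableTypeR R) -> \bar R) :
  iint (s1 ++ s2) F = iint s1 (iint s2 F).
Proof. by rewrite /iint foldr_cat. Qed.

Lemma iint_perm (R : realType) n (s1 s2 : seq 'I_n)
    (F : n.-tuple (measurableTypeR R) -> \bar R) : nnmeas F ->
  perm_eq s1 s2 -> iint s1 F = iint s2 F.
Proof.
move=> mF; elim: s1 s2 => [|i s1 IH] s2 p12.
  by move: p12; rewrite perm_sym => /perm_nilP ->.
have is2 : i \in s2 by rewrite -(perm_mem p12) mem_head.
move: p12; case/splitPr: is2 => s3 s4 p12.
rewrite (_ : iint (i :: s1) F = pint i (iint s1 F))// (IH (s3 ++ s4)); last first.
  by rewrite -(perm_cons i) (perm_trans p12)// perm_sym -cat1s perm_catCA.
rewrite !iint_cat -cat1s iint_cat /=.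
elim: s3 {p12} => //= j s3 <-.
by rewrite pint_comm//; do 2 apply: nnmeas_iint.
Qed.

(** Only points that agree with [x] outside [s] are ever evaluated. This lets a coordinate outside
    [s] be treated as a constant under the integral. *)
Lemma eq_iint (R : realType) n (s : seq 'I_n)
    (F G : n.-tuple (measurableTypeR R) -> \bar R) x :
  (forall y, (forall j, j \notin s -> tnth y j = tnth x j) -> F y = G y) ->
  iint s F x = iint s G x.
Proof.
elim: s x => [|i s IH] x FG /=; first exact: FG.
apply: eq_integral => t _; apply: IH => y xy; apply: FG => j.
rewrite inE negb_or => /andP[ji js]; rewrite xy// tnth_upd.
by rewrite (negbTE ji).
Qed.

Lemma iintZl (R : realType) n (s : seq 'I_n) (c : \bar R)
    (F : n.-tuple (measurableTypeR R) -> \bar R) : nnmeas F -> (0 <= c)%E ->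
  iint s (fun x => c * F x)%E = (fun x => c * iint s F x)%E.
Proof.
move=> mF c0; elim: s => //= i s ->; apply/funext => x.
have [mI I0] := nnmeas_comp (nnmeas_iint s mF) (measurable_upd1 i x).
exact: (ge0_integralZl _ measurableT mI (fun t _ => I0 t) c0).
Qed.

Lemma iint_sum (R : realType) n (s : seq 'I_n) (J : finType)
    (F : J -> n.-tuple (measurableTypeR R) -> \bar R) :
  (forall j, nnmeas (F j)) ->
  iint s (fun x => \sum_j F j x)%E = (fun x => \sum_j iint s (F j) x)%E.
Proof.
move=> mF; elim: s => //= i s ->; apply/funext => x.
rewrite /pint ge0_integral_sum// => j.
  by have [] := nnmeas_comp (nnmeas_iint s (mF j)) (measurable_upd1 i x).
by move=> y _; have [_ ->] := (nnmeas_iint s (mF j)).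
Qed.

(** Joint measurability in the parameter and the point is what Tonelli's theorem asks for when an
    integral over the parameter is moved past the coordinates. *)
Lemma nnmeas_iint_param d (T : measurableType d) (R : realType) n (s : seq 'I_n)
    (F : T -> n.-tuple (measurableTypeR R) -> \bar R) :
  nnmeas (fun p : T * n.-tuple (measurableTypeR R) => F p.1 p.2) ->
  nnmeas (fun p : T * n.-tuple (measurableTypeR R) => iint s (F p.1) p.2).
Proof.
move=> mF; elim: s => //= i s mI.
apply: (@nnmeas_fun_integral _ _ _
  (fun q : measurableTypeR R * (T * n.-tuple (measurableTypeR R)) =>
    iint s (F q.2.1) (upd i q.1 q.2.2))).
apply: (nnmeas_comp (f := fun q => (q.2.1, upd i q.1 q.2.2)) mI).
apply: measurable_fun_pair => /=.
  exact: (measurableT_comp measurable_fst measurable_snd).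
apply: (measurableT_comp
  (f := fun q : measurableTypeR R * n.-tuple (measurableTypeR R) => upd i q.1 q.2)
  (g := fun q : measurableTypeR R * (T * n.-tuple (measurableTypeR R)) =>
    (q.1, q.2.2))).
  exact: measurable_upd.
apply: measurable_fun_pair; first exact: measurable_fst.
exact: (measurableT_comp measurable_snd measurable_snd).
Qed.

Lemma iint_integral (R : realType) n (s : seq 'I_n)
    (F : measurableTypeR R -> n.-tuple (measurableTypeR R) -> \bar R) :
  nnmeas (fun p : measurableTypeR R * n.-tuple (measurableTypeR R) => F p.1 p.2) ->
  forall x, iint s (fun x => \int[lebesgue_measure]_t F t x)%E x =
  (\int[lebesgue_measure]_t iint s (F t) x)%E.
Proof.
move=> mF; elim: s => //= i s IH x; rewrite /pint.
under eq_integral do rewrite IH.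
have mm : measurable_fun setT (fun p : measurableTypeR R * measurableTypeR R =>
    (p.2, upd i p.1 x)).
  apply: measurable_fun_pair; first exact: measurable_snd.
  exact: (measurableT_comp (measurable_upd1 i x) measurable_fst).
have [h1 h2] := nnmeas_comp (nnmeas_iint_param s mF) mm.
by rewrite (@fubini_tonelli _ _ _ _ _ lebesgue_measure lebesgue_measure _ h1 h2).
Qed.

(** The recursion of [lebesgue_tuple] integrates the measures of the sections over the head, which
    is one partial integral. Since every coordinate is integrated, the base point [x] is
    arbitrary. *)
Lemma lebesgue_tupleE (R : realType) n (A : set (n.-tuple (measurableTypeR R))) x :
  lebesgue_tuple A = iint (enum 'I_n) (fun y => (\1_A y)%:E) x.
Proof.
elim: n A x => [|n IH] A x.
  rewrite (_ : enum 'I_0 = [::]) /=; last by apply: size0nil; rewrite size_enum_ord.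
  by rewrite diracE indicE (tuple0 x).
rewrite enum_ordSl /= /pint /= /pushforward /product_measure1 /=.
apply: eq_integral => t _.
(* With the head fixed at [t], integrating over the shifted coordinates is integrating over the
   tail. *)
have iintS s (F : n.+1.-tuple (measurableTypeR R) -> \bar R) y :
    iint (map (lift ord0) s) F (cons_tuple t y) =
    iint s (fun y => F (cons_tuple t y)) y.
  elim: s y => //= i s IHs y; apply: eq_integral => u _.
  rewrite -IHs; congr iint.
  apply: eq_from_tnth => k; rewrite tnth_upd.
  case: (unliftP ord0 k) => [j ->|->]; last by rewrite !tnth0.
  by rewrite !tnthS tnth_upd (inj_eq lift_inj).
rewrite (_ : upd _ _ _ = cons_tuple t (behead_tuple x)); last first.
  apply: eq_from_tnth => k; rewrite tnth_upd.
  case: (unliftP ord0 k) => [j ->|->]; rewrite ?tnthS ?tnth0 ?eqxx//=.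
  by rewrite tnth_behead; congr tnth; apply/val_inj => /=; rewrite inordK// ltnS.
rewrite iintS (IH _ (behead_tuple x)).
congr (iint _ _ _); apply/funext => y; rewrite !indicE; congr ((nat_of_bool _)%:R%:E).
by apply/idP/idP; rewrite /xsection ?inE /=; rewrite ?inE.
Qed.

(** * One-dimensional integrals *)

(** Lebesgue measure is [c] times its own image under the affine map: the two agree on half-open
    intervals, and this determines the measure. *)
Lemma ge0_integral_affine (R : realType) (f : measurableTypeR R -> \bar R) (b c : R) :
  nnmeas f -> 0 < c ->
  (\int[@lebesgue_measure R]_t f t = c%:E * \int[@lebesgue_measure R]_t f (b + c * t)%R)%E.
Proof.
move=> [mf f0] c0.
pose g (t : measurableTypeR R) : measurableTypeR R := b + c * t.
have mg : measurable_fun setT g.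
  by apply: measurable_funD => //; exact: measurable_funM.
pose c' := NngNum (ltW c0).
pose mg_mixin := isMeasurableFun.Build _ _ _ _ _ mg.
pose mg_pack : {mfun _ >-> _} := HB.pack g mg_mixin.
pose mu : {measure set _ -> \bar R} := pushforward (@lebesgue_measure R) mg_pack.
pose nu : {measure set _ -> \bar R} := mscale c' (mu mg).
rewrite (eq_measure_integral nu) => [|A mA _]; last first.
  apply: lebesgue_measure_unique => // X [[x y] _ <-] /=.
  rewrite /mscale /= /pushforward.
  rewrite (_ : g @^-1` _ = `](x - b) / c, (y - b) / c]%classic); last first.
    apply/seteqP; split => t /=; rewrite !in_itv /= /g.
      by rewrite ltr_pdivrMr // ler_pdivlMr // ltrBlDl lerBrDl ![c * _]mulrC.
    by rewrite ltr_pdivrMr // ler_pdivlMr // ltrBlDl lerBrDl ![c * _]mulrC.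
  transitivity (lebesgue_measure (`]x, y]%classic : set R)) => //.
  pose I : set R := `](x - b) / c, (y - b) / c]%classic.
  transitivity (c%:E * lebesgue_measure I)%E => //.
  rewrite !lebesgue_measure_itv /= !lte_fin ltr_pM2r ?invr_gt0 // ltrD2r.
  case: ifP => _; last by rewrite mule0.
  by rewrite -!EFinB -EFinM; congr EFin; field; rewrite gt_eqF.
rewrite ge0_integral_mscale //; congr (_ * _)%E.
by rewrite (@ge0_integral_pushforward _ _ _ _ _ g mg).
Qed.

Lemma integral_expRN_ge (R : realType) (a : R) :
  (\int[@lebesgue_measure R]_t ((a <= t :> R)%:R * expR (- t))%R%:E = (expR (- a)%R)%:E)%E.
Proof.
transitivity (\int[@lebesgue_measure R]_(t in `[a, +oo[) (expR (- t)%R)%:E)%E.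
  rewrite [RHS]integral_mkcond; apply: eq_integral => t _.
  rewrite patchE /=; case: (boolP (a <= t)) => h.
    by rewrite mul1r mem_set //= in_itv /= h.
  by rewrite mul0r memNset //= in_itv /= andbT; exact/negP.
have dF (x : R) : is_derive x 1 (fun x => - expR (- x)) (expR (- x)).
  by apply: is_derive_eq; rewrite /GRing.scale /=; ring.
rewrite (@ge0_continuous_FTC2y _ _ (fun x => - expR (- x)) _ 0).
- by rewrite sub0e -EFinN opprK.
- by move=> x _; exact: expR_ge0.
- apply: continuous_subspaceT => x.
  by apply: continuous_comp; [exact: opp_continuous|exact: continuous_expR].
- by rewrite -[X in _ --> X]oppr0; apply: cvgN; exact: cvgr_expR.
- by move=> x _; have [] := dF x.
- apply: cvg_at_right_filter; apply: cvgN.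
  by apply: continuous_comp; [exact: opp_continuous|exact: continuous_expR].
- by move=> x _; rewrite derive1E; have [] := dF x.
Qed.

(** The induction step for the volume of a simplex: the slice at [t] is a simplex of size
    [tau - l^-1 * t], whose volume is proportional to the [k]-th power of that size. The indicator
    of a positive size is kept because the power alone does not vanish for negative sizes. *)
Lemma integral_simplex_step (R : realType) (l tau : R) (k : nat) : 0 < l ->
  (\int[@lebesgue_measure R]_t
    ((0 < t :> R)%:R * ((0 < tau - l^-1 * t :> R)%:R * (tau - l^-1 * t) ^+ k))%R%:E =
   ((0 < tau :> R)%:R * (l * tau ^+ k.+1 / k.+1%:R))%R%:E)%E.
Proof.
move=> l0.
pose G (t : R) : R := tau - l^-1 * t.
pose F : R -> R := - (l / k.+1%:R) *: (G ^+ k.+1).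
have FE t : F t = - (l / k.+1%:R) * (tau - l^-1 * t) ^+ k.+1.
  by rewrite /F !fctE.
have dF (x : R) : is_derive x 1 F ((tau - l^-1 * x) ^+ k).
  have dG : is_derive x 1 G (- l^-1).
    by apply: is_derive_eq; rewrite /GRing.scale /=; ring.
  rewrite /F; apply: is_derive_eq.
  rewrite /GRing.scale /= /G -mulr_natl; field.
  by rewrite gt_eqF //= nat1r pnatr_eq0.
(* If [tau <= 0], no positive [t] leaves a positive size, and both sides are 0. *)
have [tau0|tau0] := leP tau 0.
  rewrite mul0r integral0_eq// => t _; case: ltP => t0; rewrite ?mul0r//.
  rewrite ltNge (_ : (_ <= _)); first by rewrite mul0r mulr0.
  by rewrite subr_le0 (le_trans tau0)// mulr_ge0 ?invr_ge0 ?ltW.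
rewrite mul1r.
have tl0 : 0 < tau * l by rewrite mulr_gt0.
transitivity (\int[@lebesgue_measure R]_(t in `]0%R, (tau * l)%R[) ((tau - l^-1 * t) ^+ k)%R%:E)%E.
  rewrite [RHS]integral_mkcond; apply: eq_integral => t _.
  have E : (0 < tau - l^-1 * t) = (t < tau * l).
    by rewrite subr_gt0 mulrC ltr_pdivrMr.
  rewrite patchE /=; case: ifPn; rewrite ?inE ?notin_setE /= in_itv /= E.
    by move=> /andP[-> ->]; rewrite !mul1r.
  by move=> /negP; case: (0 < t); case: (t < _) => //=; rewrite ?mul0r ?mulr0.
have cf : continuous (fun t : R => (tau - l^-1 * t) ^+ k : R).
  move=> x; apply: (@continuous_comp _ _ _ (fun t : R => tau - l^-1 * t)
    (fun u : R => u ^+ k)); last exact: exprn_continuous.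
  apply: cvgB; first exact: cvg_cst.
  by apply: cvgM; [exact: cvg_cst|exact: cvg_id].
have cF : continuous F.
  by move=> x; apply/differentiable_continuous/derivable1_diffP; have [] := dF x.
rewrite -(@integral_itv_bndoo _ _ _ _ true false); last first.
  apply/measurable_EFinP; apply: measurable_funTS; exact: continuous_measurable_fun.
rewrite (@continuous_FTC2 _ _ F) //.
- rewrite -EFinB !FE; congr EFin; rewrite mulr0 subr0.
  rewrite (_ : tau - l^-1 * (tau * l) = 0); last by field; rewrite gt_eqF.
  by rewrite expr0n /= mulr0 sub0r mulNr opprK mulrAC.
- exact: continuous_subspaceT.
- split; [by move=> x _; have [] := dF x| |].
  + by apply: cvg_at_right_filter; exact: cF.
  + by apply: cvg_at_left_filter; exact: cF.
- by move=> x _; rewrite derive1E; have [] := dF x.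
Qed.

Lemma integral_gauss_le (R : realType) (b : R) :
  (\int[@lebesgue_measure R]_t ((t <= b :> R)%:R * expR (- t ^+ 2 / 2))%R%:E =
   (Num.sqrt (2 * pi) * Phi b)%R%:E)%E.
Proof.
have s0 : 0 < Num.sqrt (2 * pi) :> R by rewrite sqrtr_gt0 mulr_gt0 ?pi_gt0.
have iphi : lebesgue_measure.-integrable setT (EFin \o @phi R).
  by rewrite phiE; exact: integrable_normal_pdf.
have iphib : lebesgue_measure.-integrable `]-oo, b] (EFin \o @phi R).
  exact: integrableS iphi.
rewrite /Phi /Rintegral EFinM fineK; last exact: integrable_fin_num.
rewrite -integralZl// [RHS]integral_mkcond; apply: eq_integral => t _.
rewrite patchE /=; case: ifPn; rewrite ?inE ?notin_setE /= in_itv /=.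
  by move=> ->; rewrite mul1r /phi -EFinM mulrA divff ?gt_eqF// mul1r.
by move=> /negP/negbTE ->; rewrite mul0r.
Qed.

Lemma Phi_ge0_le1 (R : realType) (b : R) : 0 <= Phi b <= 1.
Proof.
have iphi : lebesgue_measure.-integrable setT (EFin \o @phi R).
  by rewrite phiE; exact: integrable_normal_pdf.
have phi0 (t : R) : 0 <= phi t by rewrite phiE normal_pdf_ge0.
apply/andP; split; first by apply: Rintegral_ge0 => t _; exact: phi0.
rewrite -lee_fin /Phi /Rintegral fineK; last first.
  by apply: integrable_fin_num => //; exact: integrableS iphi.
rewrite -(@integral_normal_pdf R 0 1) -phiE.
apply: ge0_subset_integral => //.
  by case/integrableP: iphi.
by move=> t _; rewrite lee_fin.
Qed.

(** * Nearest points of the simplex *)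

(** The Lagrange multiplier of the nearest-point problem on the affine hull of the face [I]:
    subtracting [mult a x I * a i] from the coordinates in [I] lands on the hyperplane of the
    simplex. *)
Definition mult (R : realType) n (a x : 'I_n -> R) (I : {set 'I_n}) : R :=
  (\sum_(i in I) a i * x i - 1) / \sum_(i in I) a i ^+ 2.

(** A self-consistency condition: the multiplier computed from [I] must give back [I] as the set of
    coordinates that stay positive. *)
Definition region (R : realType) n (a : 'I_n -> R) (I : {set 'I_n}) (x : 'I_n -> R) : bool :=
  (I != finset.set0) && [forall i, (i \in I) == (mult a x I * a i < x i)].

Definition sqdist (R : realType) n (a : 'I_n -> R) (I : {set 'I_n}) (x : 'I_n -> R) : R :=
  mult a x I ^+ 2 * (\sum_(i in I) a i ^+ 2) + \sum_(i in ~: I) x i ^+ 2.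

Lemma sum_sqr_gt0 (R : realType) n (a : 'I_n -> R) (I : {set 'I_n}) :
  (forall i, 0 < a i) -> I != finset.set0 -> 0 < \sum_(i in I) a i ^+ 2.
Proof.
move=> a0 /set0Pn[i iI]; rewrite (bigD1 i)//= ltr_wpDr ?exprn_gt0//.
by apply: sumr_ge0 => j _; rewrite exprn_ge0// ltW.
Qed.

Lemma sum_mult (R : realType) n (a x : 'I_n -> R) (I : {set 'I_n}) :
  (forall i, 0 < a i) -> I != finset.set0 ->
  \sum_(i in I) a i * (x i - mult a x I * a i) = 1.
Proof.
move=> a0 I0.
under eq_bigr do rewrite mulrBr mulrCA -expr2.
rewrite big_split /= sumrN -mulr_sumr /mult divfK ?gt_eqF ?sum_sqr_gt0//.
by rewrite opprB addrC subrK.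
Qed.

Lemma mult_uniq (R : realType) n (a x : 'I_n -> R) (I : {set 'I_n}) t :
  (forall i, 0 < a i) -> I != finset.set0 ->
  \sum_(i in I) a i * (x i - t * a i) = 1 -> mult a x I = t.
Proof.
move=> a0 I0; under eq_bigr do rewrite mulrBr mulrCA -expr2.
rewrite big_split /= sumrN -mulr_sumr /mult => <-.
by rewrite opprB addrC subrK mulfK// gt_eqF ?sum_sqr_gt0.
Qed.

(** The intermediate value theorem yields a [t] at which the positive parts of [x i - t * a i],
    weighted by [a i], sum to 1; [I] collects the indices where the positive part is not 0. *)
Lemma region_exists (R : realType) n (a x : 'I_n -> R) : (0 < n)%N ->
  (forall i, 0 < a i) -> exists I, region a I x.
Proof.
case: n a x => // n a x _ a0.
pose u i (t : R) := x i - t * a i.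
(* The positive part is written with an absolute value, which makes continuity immediate. *)
pose g (t : R) := \sum_i a i * ((u i t + `|u i t|) / 2).
have pos v : (v + `|v|) / 2 = if 0 < v then v else 0 :> R.
  by case: ltrP => v0; [rewrite gtr0_norm//; field|rewrite ler0_norm// subrr mul0r].
have term0 i t : 0 <= a i * ((u i t + `|u i t|) / 2).
  by rewrite pos mulr_ge0 ?(ltW (a0 i))//; case: ifP => // /ltW.
have cg : continuous g.
  move=> t; apply: cvg_big => [|i _]; first exact: add_continuous.
  apply: cvgM; first exact: cvg_cst.
  apply: cvgM; last exact: cvg_cst.
  have cu : u i z @[z --> t] --> u i t.
    apply: cvgB; first exact: cvg_cst.
    by apply: cvgM; [exact: cvg_id|exact: cvg_cst].
  by apply: cvgD => //; exact: cvg_norm.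
(* At [t0] the summand of index 0 alone is 1; [t1] is at least every [x i / a i], so all summands
   vanish there. *)
pose t0 := (a ord0 * x ord0 - 1) / a ord0 ^+ 2.
pose t1 := \sum_i `|x i| / a i.
have t1i i : x i / a i <= t1.
  rewrite (le_trans (y := `|x i| / a i))// ?ler_pM2r ?invr_gt0 ?ler_norm//.
  rewrite /t1 (bigD1 i)//= lerDl sumr_ge0// => j _.
  by rewrite mulr_ge0 ?invr_ge0 ?(ltW (a0 j)).
have t01 : t0 <= t1.
  apply: le_trans (t1i ord0); rewrite /t0 ler_pdivrMr ?exprn_gt0//.
  rewrite expr2 mulrA divfK ?gt_eqF// mulrC.
  by rewrite gerDl lerN10.
have g0 : 1 <= g t0.
  rewrite /g (bigD1 ord0)//= -[leLHS]addr0 lerD//; last exact: sumr_ge0.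
  have -> : u ord0 t0 = (a ord0)^-1.
    by rewrite /u /t0; field; rewrite gt_eqF.
  by rewrite pos invr_gt0 a0 mulfV// gt_eqF.
have g1 : g t1 = 0.
  rewrite /g big1// => i _; rewrite pos ifN ?mulr0// -leNgt /u subr_le0.
  by rewrite -ler_pdivrMr.
have [|t _ gt] := @IVT R g t0 t1 1 t01 (continuous_subspaceT cg).
  by rewrite g1 minC maxC min_l ?max_r ?ler01 ?(le_trans ler01).
pose I := [set i | t * a i < x i]%SET.
have sI : \sum_(i in I) a i * (x i - t * a i) = 1.
  rewrite -gt /g big_mkcond /=; apply: eq_bigr => i _.
  by rewrite pos inE /u subr_gt0; case: ifP => //; rewrite mulr0.
have I0 : I != finset.set0.
  by apply: contra_eq_neq sI => ->; rewrite big_set0 eq_sym oner_neq0.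
exists I; rewrite /region I0 /=; apply/forallP => i.
by rewrite (mult_uniq a0 I0 sI) inE.
Qed.

Lemma regionP (R : realType) n (a x : 'I_n -> R) (I : {set 'I_n}) :
  reflect (I != finset.set0 /\ I = [set i | mult a x I * a i < x i]%SET) (region a I x).
Proof.
apply: (iffP andP) => -[I0 h]; split => //.
  by apply/setP => i; rewrite inE; apply/eqP/(forallP h).
by apply/forallP => i; rewrite {1}h inE.
Qed.

(** Lowering the multiplier strictly raises the weighted sum of the positive parts, yet both sums
    are 1. So the multipliers agree, and each determines its set. *)
Lemma region_uniq (R : realType) n (a x : 'I_n -> R) (I J : {set 'I_n}) :
  (forall i, 0 < a i) -> region a I x -> region a J x -> I = J.
Proof.
move=> a0 /regionP[I0 EI] /regionP[J0 EJ].
suff key I' J' : I' != finset.set0 -> I' = [set i | mult a x I' * a i < x i]%SET ->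
    J' != finset.set0 -> J' = [set i | mult a x J' * a i < x i]%SET ->
    ~~ (mult a x I' < mult a x J').
  suff e : mult a x I = mult a x J by rewrite EI EJ e.
  by apply/eqP; rewrite eq_le !leNgt !key.
move=> I'0 EI' J'0 EJ'; apply/negP => lt.
have := sum_mult x a0 J'0; rewrite -(sum_mult x a0 I'0).
apply/eqP; rewrite lt_eqF//.
apply: (@lt_le_trans _ _ (\sum_(i in J') a i * (x i - mult a x I' * a i))).
  have [j jJ] := set0Pn _ J'0; apply: ltr_sum.
    by apply/hasP; exists j; rewrite ?mem_index_enum.
  by move=> i _; rewrite ltr_pM2l// ltrD2l ltrN2 ltr_pM2r.
(* The smaller multiplier keeps more coordinates positive, and the additional terms are
   nonnegative. *)
have JI : J' \subset I'.
  apply/fintype.subsetP => i; rewrite EJ' EI' !inE; apply: lt_trans.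
  by rewrite ltr_pM2r.
rewrite [leRHS](big_setID J') /= (finset.setIidPr JI) lerDl sumr_ge0// => i.
rewrite inE => /andP[_]; rewrite {1}EI' inE => h.
by rewrite mulr_ge0 ?ltW// subr_gt0.
Qed.

(* [x - y] is the multiplier times [a] on the face and at most that elsewhere, so
   that every [z] in the simplex is at an obtuse angle from [x] seen from [y]. *)
Lemma sqdistP (R : realType) n (a x : 'I_n -> R) (I : {set 'I_n}) (rho : R) :
  (forall i, 0 < a i) -> region a I x ->
  (exists z : 'I_n -> R, [/\ forall i, 0 <= z i, \sum_i a i * z i = 1 &
     \sum_i (x i - z i) ^+ 2 <= rho]) <-> sqdist a I x <= rho.
Proof.
move=> a0 /regionP[I0 EI].
pose t := mult a x I; pose y i := if i \in I then x i - t * a i else 0.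
have y0 i : 0 <= y i.
  by rewrite /y EI inE; case: ifP => // h; rewrite subr_ge0 ltW.
have sy : \sum_i a i * y i = 1.
  rewrite -(sum_mult x a0 I0) [RHS]big_mkcond /=; apply: eq_bigr => i _.
  by rewrite /y; case: ifP => //; rewrite mulr0.
have sqy : sqdist a I x = \sum_i (x i - y i) ^+ 2.
  rewrite /sqdist [RHS](bigID (mem I)) /=; congr (_ + _).
    rewrite mulr_sumr; apply: eq_bigr => i iI.
    by rewrite /y iI /t; ring.
  by apply: eq_big => [i|i]; rewrite inE // => iI; rewrite /y (negbTE iI) subr0.
split => [[z [z0 sz]]|h].
  apply: le_trans; rewrite sqy.
  (* Both [y] and [z] satisfy the constraint, so this sum vanishes. Adding it to the smaller side
     makes the comparison of squared distances hold coordinate by coordinate. *)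
  have e : \sum_i 2 * t * (a i * y i - a i * z i) = 0.
    by rewrite -mulr_sumr big_split /= sumrN sy sz subrr mulr0.
  rewrite -[leLHS]addr0 -[X in _ + X <= _]e -big_split /=; apply: ler_sum => i _.
  have h : t * a i * (y i - z i) <= (x i - y i) * (y i - z i).
    rewrite /y; case: ifPn => iI; first by rewrite subKr.
    rewrite subr0 sub0r !mulrN lerN2 ler_wpM2r//.
    by move: iI; rewrite {1}EI inE -leNgt.
  have := sqr_ge0 (y i - z i); nra.
by exists y; split => //; rewrite -sqy.
Qed.

(** * The parallel body of the simplex in coordinates *)

(** Convexity concerns two points at a time. Leaving the weights unnormalised lets the induction
    hypothesis apply to the tail as it stands. *)
Lemma convex_set_sum (R : realType) n (M : set 'rV[R]_n) (J : eqType)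
    (s : seq J) (t : J -> R) (v : J -> 'rV[R]_n) :
  @convex_set R 'rV[R]_n M -> (forall j, 0 <= t j) -> (forall j, M (v j)) ->
  0 < \sum_(j <- s) t j ->
  M ((\sum_(j <- s) t j)^-1 *: \sum_(j <- s) t j *: v j).
Proof.
move=> cM t0 Mv; elim: s => [|j s IH]; first by rewrite big_nil ltxx.
rewrite !big_cons => T0.
have : 0 <= \sum_(j <- s) t j by apply: sumr_ge0.
(* If the tail has total weight 0, all its weights are 0 and the average is the head itself. *)
rewrite le_eqVlt => /orP[/eqP T'|T'].
  have -> : \sum_(j <- s) t j *: v j = 0.
    rewrite big_seq big1// => k ks.
    move/esym/eqP : T'; rewrite psumr_eq0// => /allP/(_ k ks)/eqP ->.
    by rewrite scale0r.
  rewrite -T' !addr0 scalerA mulVf ?scale1r//.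
  by rewrite gt_eqF//; rewrite -T' addr0 in T0.
set T := \sum_(j <- s) t j in T0 T' IH *.
set V := \sum_(j <- s) _ in IH *.
have p0 : 0 <= t j / (t j + T) by rewrite divr_ge0// ltW.
have p1 : t j / (t j + T) <= 1 by rewrite ler_pdivrMr// mul1r lerDl ltW.
have := cM (v j) (T^-1 *: V) (Itv01 p0 p1).
rewrite !inE => /(_ (Mv j) (IH T')).
congr (M _).
rewrite /conv /= /unstable.onem scalerA scalerDr scalerA [_^-1 * t j]mulrC; congr (_ + _ *: _).
by field; rewrite !gt_eqF.
Qed.

(** The right-hand set is convex and contains the vertices; conversely, its point [y] is the
    combination of the vertices with weights [y i / l i]. *)
Lemma conv_hull_simplex (R : realType) n (l : 'I_n -> R) : (forall i, 0 < l i) ->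
  conv_hull [set l i *: delta_mx ord0 i | i in [set: 'I_n]] =
  [set y : 'rV[R]_n | (forall i, 0 <= y ord0 i) /\ \sum_i (l i)^-1 * y ord0 i = 1].
Proof.
move=> l0; apply/seteqP; split.
  apply: smallest_sub.
    move=> x y p; rewrite !inE /= => -[x0 sx] [y0 sy]; split => [i|].
      by rewrite /conv /= !mxE addr_ge0// mulr_ge0// unstable.onem_ge0.
    rewrite /conv /=; under eq_bigr do rewrite !mxE mulrDr mulrCA [X in _ + X]mulrCA.
    by rewrite big_split /= -!mulr_sumr sx sy !mulr1 /unstable.onem addrC subrK.
  move=> _ [i _ <-] /=; split => [j|].
    by rewrite !mxE mulr_ge0 ?(ltW (l0 i)).
  rewrite (bigD1 i)//= big1 => [|j ji]; last by rewrite !mxE (negbTE ji) mulr0 mulr0.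
  by rewrite !mxE !eqxx mulr1 mulVf ?addr0// gt_eqF.
move=> y /= [y0 sy] M [cM GM].
have := @convex_set_sum R n M 'I_n (index_enum 'I_n) (fun i => (l i)^-1 * y ord0 i)
  (fun i => l i *: delta_mx ord0 i) cM.
rewrite sy invr1 scale1r => h.
rewrite (_ : y = \sum_i ((l i)^-1 * y ord0 i) *: (l i *: delta_mx ord0 i)).
  apply: h => // [j|j]; first by rewrite mulr_ge0 ?invr_ge0 ?(ltW (l0 j)).
  by apply: GM; exists j.
rewrite [LHS]row_sum_delta; apply: eq_bigr => i _.
by rewrite scalerA mulrAC mulVf ?mul1r// gt_eqF.
Qed.

Lemma minkowski_simplex_ball (R : realType) n (l : 'I_n -> R) (r : R) (x : 'rV[R]_n) :
  (forall i, 0 < l i) -> 0 <= r ->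
  minkowski_sum (conv_hull [set l i *: delta_mx ord0 i | i in [set: 'I_n]])
    (dilate r (@unit_ball R n)) x <->
  (exists z : 'I_n -> R, [/\ forall i, 0 <= z i, \sum_i (l i)^-1 * z i = 1 &
     \sum_i (x ord0 i - z i) ^+ 2 <= r ^+ 2]).
Proof.
move=> l0 r0; rewrite conv_hull_simplex//; split.
  move=> [y [y0 sy] [_ [u u1 <-] <-]]; exists (y ord0); split => //.
  under eq_bigr do rewrite !mxE addrAC subrr add0r exprMn.
  rewrite -mulr_sumr ler_piMr ?exprn_ge0//.
  have s0 : 0 <= \sum_i u ord0 i ^+ 2 by apply: sumr_ge0 => i _; rewrite sqr_ge0.
  rewrite -(sqr_sqrtr s0) -[leRHS](expr1n _ 2) ler_sqr ?nnegrE ?sqrtr_ge0//.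
move=> [z [z0 sz h]]; exists (\row_i z i) => /=.
  by split => [i|]; rewrite ?mxE//; under eq_bigr do rewrite mxE.
exists (x - \row_i z i); last by rewrite addrC subrK.
(* For [r = 0] the convention [0^-1 = 0] makes this witness the origin, and [x = z] is then drawn
   from the vanishing sum of squares. *)
exists (r^-1 *: (x - \row_i z i)).
  rewrite /unit_ball /=; under eq_bigr do rewrite !mxE exprMn.
  rewrite -mulr_sumr -[leRHS](@sqrtr1 R) ler_wsqrtr//.
  have [->|rn0] := eqVneq r 0; first by rewrite invr0 expr0n mul0r ler01.
  by rewrite exprVn mulrC ler_pdivrMr ?mul1r// exprn_gt0// lt_neqAle eq_sym rn0.
have [E|rn0] := eqVneq r 0; last by rewrite scalerA mulfV// scale1r.
rewrite E scale0r; apply/rowP => i; rewrite !mxE.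
have /eqP : \sum_i (x ord0 i - z i) ^+ 2 = 0.
  apply/eqP; rewrite eq_le sumr_ge0 ?andbT => [|j _]; last exact: sqr_ge0.
  by move: h; rewrite E expr0n.
rewrite psumr_eq0 => [|j _]; last exact: sqr_ge0.
by move=> /allP/(_ i (mem_index_enum _)); rewrite sqrf_eq0 => /eqP.
Qed.

(** * Changes of variables *)

(* [tnth] at type [R], for [measurableTypeR R] has no order structure. *)
Definition crd (R : realType) n (x : n.-tuple (measurableTypeR R)) (i : 'I_n) : R :=
  tnth x i.

Lemma crd_upd (R : realType) n (i j : 'I_n) t (x : n.-tuple (measurableTypeR R)) :
  crd (upd i t x) j = if j == i then t else crd x j.
Proof. exact: tnth_upd. Qed.

Lemma measurable_crd (R : realType) n (i : 'I_n) :
  measurable_fun setT (fun x : n.-tuple (measurableTypeR R) => crd x i).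
Proof. exact: measurable_tnth. Qed.

Lemma nnmeas_EFin d (T : measurableType d) (R : realType) (f : T -> R) :
  measurable_fun setT f -> (forall x, 0 <= f x) -> nnmeas (fun x => (f x)%:E).
Proof. by move=> mf f0; split => [|x]; [exact/measurable_EFinP|rewrite lee_fin]. Qed.

Lemma measurable_ind_le d (T : measurableType d) (R : realType) (u v : T -> R) :
  measurable_fun setT u -> measurable_fun setT v ->
  measurable_fun setT (fun x => (u x <= v x)%R%:R : R).
Proof.
move=> mu mv.
rewrite (_ : (fun x => _) = (fun x => if ((u x)%:E <= (v x)%:E)%E then 1 else 0 : R)).
  by apply: measurable_fun_ifT => //; apply: measurable_fun_lee; exact/measurable_EFinP.
by apply/funext => x; rewrite lee_fin; case: ifP.
Qed.

Lemma measurable_ind_lt d (T : measurableType d) (R : realType) (u v : T -> R) :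
  measurable_fun setT u -> measurable_fun setT v ->
  measurable_fun setT (fun x => (u x < v x)%R%:R : R).
Proof.
move=> mu mv.
rewrite (_ : (fun x => _) = (fun x => if ((u x)%:E < (v x)%:E)%E then 1 else 0 : R)).
  by apply: measurable_fun_ifT => //; apply: measurable_fun_lte; exact/measurable_EFinP.
by apply/funext => x; rewrite lte_fin; case: ifP.
Qed.

Lemma iint_upd (R : realType) n (i : 'I_n) (s : seq 'I_n) v
    (G : n.-tuple (measurableTypeR R) -> \bar R) x : i \notin s ->
  iint s G (upd i v x) = iint s (fun y => G (upd i v y)) x.
Proof.
elim: s x => //= j s IH x; rewrite inE negb_or => /andP[ij si].
by apply: eq_integral => t _; rewrite upd_comm 1?eq_sym// IH.
Qed.

(** The shift [al] depends on the other coordinates only, so along coordinate [i] the substitution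
    is affine with constant slope [c]. *)
Lemma pint_affine (R : realType) n (i : 'I_n) (c : R)
    (al : n.-tuple (measurableTypeR R) -> R)
    (F : n.-tuple (measurableTypeR R) -> \bar R) x :
  nnmeas F -> 0 < c -> (forall t y, al (upd i t y) = al y) ->
  pint i F x = (c%:E * pint i (fun y => F (upd i (al y + c * crd y i)%R y)) x)%E.
Proof.
move=> mF c0 ali.
rewrite /pint (@ge0_integral_affine _ _ (al x) c)//; last first.
  exact: (nnmeas_comp mF (measurable_upd1 i x)).
congr (_ * _)%E; apply: eq_integral => t _.
by rewrite upd_upd ali crd_upd eqxx.
Qed.

Definition scale_on (R : realType) n (s : seq 'I_n) (rho : R)
    (x : n.-tuple (measurableTypeR R)) : n.-tuple (measurableTypeR R) :=
  [tuple if j \in s then rho * crd x j else crd x j | j < n].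

Lemma crd_scale_on (R : realType) n (s : seq 'I_n) (rho : R) x j :
  crd (scale_on s rho x) j = if j \in s then rho * crd x j else crd x j.
Proof. by rewrite /crd tnth_mktuple. Qed.

Lemma measurable_scale_on (R : realType) n (s : seq 'I_n) (rho : R) :
  measurable_fun setT (@scale_on R n s rho).
Proof.
apply/measurable_fun_tnthP => j.
rewrite (_ : _ \o _ = fun x => if j \in s then rho * crd x j else crd x j); last first.
  by apply/funext => x; exact: crd_scale_on.
case: (j \in s); last exact: measurable_crd.
by apply: measurable_funM => //; exact: measurable_crd.
Qed.

Lemma iint_scale (R : realType) n (s : seq 'I_n) (rho : R)
    (F : n.-tuple (measurableTypeR R) -> \bar R) x :
  nnmeas F -> 0 < rho -> uniq s ->
  iint s F x = ((rho ^+ size s)%:E * iint s (fun y => F (scale_on s rho y)) x)%E.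
Proof.
move=> mF rho0; elim: s x => [|i s IH] x /=.
  rewrite expr0 mul1e => _; congr F.
  by apply: eq_from_tnth => j; rewrite tnth_mktuple.
move=> /andP[si us].
have mFs s' : nnmeas (fun y => F (scale_on s' rho y)).
  exact: (nnmeas_comp mF (measurable_scale_on s' rho)).
rewrite {1}/pint.
under eq_integral do rewrite (IH _ us).
have mi := nnmeas_comp (nnmeas_iint s (mFs s)) (measurable_upd1 i x).
have [mi1 mi0] := mi.
rewrite ge0_integralZl//; last 2 first.
- by move=> t _; exact: (mi0 t).
- by rewrite lee_fin exprn_ge0// ltW.
rewrite (@ge0_integral_affine _
  (fun t => iint s (fun y => F (scale_on s rho y)) (upd i t x)) 0 rho)//.
rewrite muleA -EFinM -exprSr; congr (_ * _)%E; apply: eq_integral => t _.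
(* Seen as a second update on top of the one by [t], the update by [rho * t] can move into the
   integrand, where it is the scaling of coordinate [i]. *)
rewrite add0r -(upd_upd i (rho * t) t) iint_upd//.
apply: eq_iint => y xy; congr F; apply: eq_from_tnth => j.
rewrite !tnth_mktuple inE /crd tnth_upd; have [->|ji] := eqVneq j i => //=.
by rewrite (negbTE si) xy// tnth_upd eqxx.
Qed.

(** The indicator, in the coordinates of [s], of the open simplex of size [tau] with corner [b]. *)
Definition simp (R : realType) n (a b : 'I_n -> R) (s : seq 'I_n) (tau : R)
    (y : n.-tuple (measurableTypeR R)) : R :=
  \prod_(i <- s) (b i < crd y i)%R%:R *
  (\sum_(i <- s) a i * (crd y i - b i) < tau)%R%:R.

Lemma nnmeas_simp (R : realType) n (a b : 'I_n -> R) (s : seq 'I_n) (tau : R) :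
  nnmeas (fun y => (simp a b s tau y)%:E).
Proof.
apply: nnmeas_EFin => [|x]; last by rewrite mulr_ge0// prodr_ge0.
apply: measurable_funM.
  apply: measurable_prod => i _; apply: measurable_ind_lt => //.
  exact: measurable_crd.
apply: measurable_ind_lt => //; apply: measurable_sum => i.
apply: measurable_funM => //; apply: measurable_funB => //.
exact: measurable_crd.
Qed.

(** Fixing the first coordinate leaves a simplex in the remaining ones, of size [tau] less the share
    already used, so that [integral_simplex_step] drives the induction. *)
Lemma iint_simp (R : realType) n (l b : 'I_n -> R) (s : seq 'I_n) (tau : R) x :
  (forall i, 0 < l i) -> uniq s ->
  iint s (fun y => (simp (fun i => (l i)^-1) b s tau y)%:E) x =
  ((0 < tau :> R)%:R * (tau ^+ size s * \prod_(i <- s) l i / (size s)`!%:R))%:E.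
Proof.
move=> l0; elim: s tau x => [|i s IH] tau x /=.
  by rewrite /simp !big_nil expr0 fact0 invr1 !mul1r !mulr1.
move=> /andP[si us].
rewrite /pint.
set C := \prod_(j <- s) l j / (size s)`!%:R.
pose h (t : R) : R := (0 < t)%R%:R * ((0 < tau - (l i)^-1 * t)%R%:R *
  (tau - (l i)^-1 * t) ^+ size s).
have h0 t : 0 <= h t.
  rewrite mulr_ge0// mulrC; case: (ltrP 0 (tau - (l i)^-1 * t)) => H; last by rewrite mulr0.
  by rewrite mulr1 exprn_ge0// ltW.
have C0 : 0 <= C.
  by rewrite divr_ge0// prodr_ge0// => j _; rewrite ltW.
have mh : measurable_fun setT h.
  have mt : measurable_fun setT (fun t : R => tau - (l i)^-1 * t).
    by apply: measurable_funB => //; exact: measurable_funM.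
  apply: measurable_funM; first exact: measurable_ind_lt.
  by apply: measurable_funM; [exact: measurable_ind_lt|exact: measurable_funX].
transitivity (\int[@lebesgue_measure R]_t (C%:E * (h (t - b i)%R)%:E))%E.
  apply: eq_integral => t _.
  transitivity (iint s (fun y => ((b i < t :> R)%R%:R)%:E *
      (simp (fun i => (l i)^-1) b s (tau - (l i)^-1 * (t - b i)) y)%:E)%E (upd i t x)).
    apply: eq_iint => y xy; rewrite -EFinM; congr EFin.
    rewrite /simp !big_cons.
    have -> : crd y i = t by rewrite /crd xy// tnth_upd eqxx.
    by rewrite -mulrA ltrBrDl.
  rewrite iintZl//; last exact: nnmeas_simp.
  rewrite IH// -EFinM -EFinM; congr EFin.
  by rewrite /h /C (subr_gt0 (b i) t); ring.
rewrite ge0_integralZl//; last 2 first.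
- apply/measurable_EFinP; apply: (measurableT_comp mh).
  exact: measurable_funB.
- by move=> t _; rewrite lee_fin.
rewrite (@ge0_integral_affine _ (fun t => (h (t - b i))%:E) (b i) 1)//; last first.
  apply: nnmeas_EFin => //; apply: (measurableT_comp mh).
  exact: measurable_funB.
rewrite mul1e.
under eq_integral do rewrite mul1r (addrC (b i)) addrK.
rewrite /h integral_simplex_step// -EFinM; congr EFin.
rewrite /C big_cons factS natrM exprS; field.
by rewrite pnatr_eq0 -lt0n fact_gt0 /= nat1r pnatr_eq0.
Qed.

Lemma iint_prod (R : realType) n (f : 'I_n -> R -> R) (c : 'I_n -> R) (s : seq 'I_n) x :
  (forall i, measurable_fun setT (f i)) -> (forall i t, 0 <= f i t) ->
  (forall i, \int[@lebesgue_measure R]_t (f i t)%:E = (c i)%:E)%E -> uniq s ->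
  iint s (fun y => (\prod_(i <- s) f i (crd y i))%:E) x = (\prod_(i <- s) c i)%:E.
Proof.
move=> mf f0 fc; elim: s x => [|i s IH] x /=; first by rewrite !big_nil.
move=> /andP[si us].
have c0 j : 0 <= c j.
  by rewrite -lee_fin -fc integral_ge0// => t _; rewrite lee_fin.
have mp : nnmeas (fun y => (\prod_(i <- s) f i (crd y i))%:E).
  apply: nnmeas_EFin => [|y]; last by rewrite prodr_ge0.
  apply: measurable_prod => j _; apply: (measurableT_comp (mf j)).
  exact: measurable_crd.
rewrite big_cons [RHS]EFinM -fc -ge0_integralZr//; last 3 first.
- by apply/measurable_EFinP; exact: (mf i).
- by move=> t _; rewrite lee_fin.
- by rewrite lee_fin prodr_ge0.
apply: eq_integral => t _.
transitivity (iint s (fun y => (f i t)%:E *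
    (\prod_(i <- s) f i (crd y i))%:E)%E (upd i t x)); last first.
  by rewrite iintZl ?lee_fin// IH.
apply: eq_iint => y xy; rewrite -EFinM big_cons; congr (_ * _)%:E.
by rewrite /crd xy// tnth_upd eqxx.
Qed.

(** * The pieces of the parallel body *)

(** The indicator of the piece of the parallel body lying over the face [I]; [rho] is the square of
    the radius. *)
Definition face (R : realType) n (a : 'I_n -> R) (I : {set 'I_n}) (rho : R)
    (x : n.-tuple (measurableTypeR R)) : R :=
  (region a I (crd x))%:R * (sqdist a I (crd x) <= rho)%R%:R.

(* The coordinate [i0] holds the multiplier of the face [I]. *)
Definition cone (R : realType) n (a : 'I_n -> R) (I : {set 'I_n}) (i0 : 'I_n) (rho : R)
    (x : n.-tuple (measurableTypeR R)) : R :=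
  \prod_(i in ~: I) (crd x i <= crd x i0 * a i)%R%:R *
  (crd x i0 ^+ 2 * (\sum_(i in I) a i ^+ 2) + \sum_(i in ~: I) crd x i ^+ 2 <= rho)%R%:R.

Lemma natr_forall (R : realType) (J : finType) (P : pred J) :
  [forall i, P i]%:R = \prod_i (P i)%:R :> R.
Proof.
have [/forallP h|] := boolP [forall i, P i].
  by rewrite big1// => i _; rewrite h.
rewrite negb_forall => /existsP[i /negbTE Pi].
by rewrite (bigD1 i)//= Pi mul0r.
Qed.

Lemma measurable_mult (R : realType) n (a : 'I_n -> R) (I : {set 'I_n}) :
  measurable_fun setT (fun x : n.-tuple (measurableTypeR R) => mult a (crd x) I).
Proof.
apply: measurable_funM => //; apply: measurable_funB => //.
under eq_fun do rewrite -big_enum /=.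
apply: measurable_sum => i; apply: measurable_funM => //; exact: measurable_crd.
Qed.

Lemma nnmeas_face (R : realType) n (a : 'I_n -> R) (I : {set 'I_n}) (rho : R) :
  nnmeas (fun x => (face a I rho x)%:E).
Proof.
apply: nnmeas_EFin => [|x]; last by rewrite mulr_ge0.
apply: measurable_funM.
  rewrite /region.
  under eq_fun do rewrite -mulnb natrM natr_forall.
  apply: measurable_funM => //; apply: measurable_prod => i _.
  (* The boolean equality is a strict inequality for [i] in [I] and the opposite weak one otherwise,
     a distinction that does not depend on [x]. *)
  rewrite (_ : (fun x => _) = fun x => if i \in I then
     (mult a (crd x) I * a i < crd x i)%R%:R else
     (crd x i <= mult a (crd x) I * a i)%R%:R); last first.
    apply/funext => x; rewrite !ltNge.
    by case: (i \in I); case: (_ <= _).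
  case: (i \in I); [apply: measurable_ind_lt|apply: measurable_ind_le] => //;
    try exact: measurable_crd; apply: measurable_funM => //; exact: measurable_mult.
apply: measurable_ind_le => //; apply: measurable_funD.
  apply: measurable_funM => //; apply: measurable_funX; exact: measurable_mult.
under eq_fun do rewrite -big_enum /=.
by apply: measurable_sum => i; apply: measurable_funX; exact: measurable_crd.
Qed.

Lemma measurable_cone d (T : measurableType d) (R : realType) n (a : 'I_n -> R)
    (I : {set 'I_n}) (i0 : 'I_n) (rho : T -> R) (f : T -> n.-tuple (measurableTypeR R)) :
  measurable_fun setT rho -> measurable_fun setT f ->
  measurable_fun setT (fun p => cone a I i0 (rho p) (f p)).
Proof.
move=> mrho mf.
have mc i : measurable_fun setT (fun p => crd (f p) i).
  exact: (measurableT_comp (measurable_crd i) mf).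
apply: measurable_funM.
  under eq_fun do rewrite -big_enum /=.
  apply: measurable_prod => i _; apply: measurable_ind_le => //.
  exact: measurable_funM.
apply: measurable_ind_le => //; apply: measurable_funD.
  by apply: measurable_funM => //; exact: measurable_funX.
under eq_fun do rewrite -big_enum /=.
by apply: measurable_sum => i; exact: measurable_funX.
Qed.

Lemma cone_ge0 (R : realType) n (a : 'I_n -> R) (I : {set 'I_n}) i0 (rho : R) x :
  0 <= cone a I i0 rho x.
Proof. by rewrite mulr_ge0// prodr_ge0. Qed.

Lemma nnmeas_cone (R : realType) n (a : 'I_n -> R) (I : {set 'I_n}) (i0 : 'I_n) (rho : R) :
  nnmeas (fun x => (cone a I i0 rho x)%:E).
Proof.
apply: nnmeas_EFin => [|x]; last exact: cone_ge0.
exact: (measurable_cone a I i0 (measurable_cst rho) (@measurable_id _ _ _)).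
Qed.

Lemma eq_cone (R : realType) n (a : 'I_n -> R) (I : {set 'I_n}) i0 (rho : R) x y :
  crd x i0 = crd y i0 -> (forall i, i \in ~: I -> crd x i = crd y i) ->
  cone a I i0 rho x = cone a I i0 rho y.
Proof.
move=> h0 h; rewrite /cone h0; congr (_ * _).
  by apply: eq_bigr => i iI; rewrite h.
by congr ((_ + _ <= _)%R%:R); apply: eq_bigr => i iI; rewrite h.
Qed.

(* [shear a I i0] inverts, in the coordinate [i0], the map sending that coordinate to
   the multiplier of the face [I]. *)
Definition shear (R : realType) n (a : 'I_n -> R) (I : {set 'I_n}) (i0 : 'I_n)
    (x : n.-tuple (measurableTypeR R)) : R :=
  (a i0)^-1 * (1 - \sum_(i in I :\ i0) a i * crd x i) +
  (a i0)^-1 * (\sum_(i in I) a i ^+ 2) * crd x i0.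

Lemma measurable_shear (R : realType) n (a : 'I_n -> R) (I : {set 'I_n}) i0 :
  measurable_fun setT (@shear R n a I i0).
Proof.
apply: measurable_funD; last by apply: measurable_funM => //; exact: measurable_crd.
apply: measurable_funM => //; apply: measurable_funB => //.
under eq_fun do rewrite -big_enum /=.
by apply: measurable_sum => i; apply: measurable_funM => //; exact: measurable_crd.
Qed.

Lemma mult_shear (R : realType) n (a : 'I_n -> R) (I : {set 'I_n}) i0 x :
  (forall i, 0 < a i) -> i0 \in I ->
  mult a (crd (upd i0 (shear a I i0 x) x)) I = crd x i0.
Proof.
move=> a0 i0I; have I0 : I != finset.set0 by apply/finset.set0Pn; exists i0.
rewrite /mult (big_setD1 i0)//= crd_upd eqxx.
under eq_bigr => i do [rewrite !inE => /andP[ii0 _]; rewrite crd_upd (negbTE ii0)].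
rewrite /shear; have := sum_sqr_gt0 a0 I0; set A := \sum_(i in I) _ => A0.
by field; rewrite !gt_eqF.
Qed.

(** Once coordinate [i0] holds the multiplier, the distance bound and the conditions outside [I]
    involve only that coordinate and those outside [I]: this is the cone. The conditions inside [I]
    form a simplex whose corner moves with the multiplier. *)
Lemma face_shear (R : realType) n (a : 'I_n -> R) (I : {set 'I_n}) i0 rho x :
  (forall i, 0 < a i) -> i0 \in I ->
  face a I rho (upd i0 (shear a I i0 x) x) =
  cone a I i0 rho x * simp a (fun i => crd x i0 * a i) (enum (I :\ i0)) 1 x.
Proof.
move=> a0 i0I; have I0 : I != finset.set0 by apply/finset.set0Pn; exists i0.
rewrite /face /region I0 /= /sqdist mult_shear//.
set t := crd x i0; set A := \sum_(i in I) _.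
have uj i : i \notin I -> crd (upd i0 (shear a I i0 x) x) i = crd x i.
  by move=> iI; rewrite crd_upd ifN//; apply: contraNneq iI => ->.
have -> : \sum_(i in ~: I) crd (upd i0 (shear a I i0 x) x) i ^+ 2 =
    \sum_(i in ~: I) crd x i ^+ 2.
  by apply: eq_bigr => i; rewrite inE => iI; rewrite uj.
rewrite /cone -/t -/A [RHS]mulrAC; congr (_ * _).
rewrite natr_forall (bigID (mem I)) /= mulrC; congr (_ * _).
  rewrite (eq_bigl (fun i => i \in ~: I)) => [|i]; last by rewrite inE.
  apply: eq_bigr => i; rewrite inE => iI; rewrite uj// (negbTE iI) ltNge.
  by case: (_ <= _).
rewrite (big_setD1 i0)//= mulrC /simp !big_enum /=; congr (_ * _).
  apply: eq_bigr => i; rewrite !inE => /andP[ii0 iI].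
  by rewrite iI crd_upd (negbTE ii0) [true == _]eq_sym eqb_id.
(* The condition at [i0] becomes the slanted facet of the simplex, after multiplication by
   [a i0]. *)
rewrite i0I crd_upd eqxx [true == _]eq_sym eqb_id; congr ((nat_of_bool _)%:R).
have -> : \sum_(i in I :\ i0) a i * (crd x i - t * a i) =
    \sum_(i in I :\ i0) a i * crd x i - t * (A - a i0 ^+ 2).
  rewrite /A [in RHS](big_setD1 i0 i0I) /= [a i0 ^+ 2 + _]addrC addrK mulr_sumr -sumrB.
  by apply: eq_bigr => i _; ring.
rewrite /shear -/t -/A -mulrA -mulrDr ltr_pdivlMl ?a0//.
by rewrite -subr_gt0 -[in RHS]subr_gt0; congr (0 < _); ring.
Qed.

(** The substitution in coordinate [i0] contributes its slope [l i0 * A], and the simplex in the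
    other coordinates of [I] contributes its volume, which does not depend on its corner. *)
Lemma iint_face (R : realType) n (l : 'I_n -> R) (I : {set 'I_n}) i0 rho x :
  (forall i, 0 < l i) -> i0 \in I ->
  iint (enum 'I_n) (fun x => (face (fun i => (l i)^-1) I rho x)%:E) x =
  (((#|I| - 1)`!%:R^-1 * (\prod_(i in I) l i) * (\sum_(i in I) (l i)^-1 ^+ 2))%:E *
   iint (i0 :: enum (~: I)) (fun x => (cone (fun i => (l i)^-1) I i0 rho x)%:E) x)%E.
Proof.
move=> l0 i0I; set a := fun i => (l i)^-1.
have a0 i : 0 < a i by rewrite invr_gt0.
have I0 : I != finset.set0 by apply/finset.set0Pn; exists i0.
set A := \sum_(i in I) _.
have A0 : 0 < A by apply: sum_sqr_gt0.
set F := fun x => (face a I rho x)%:E.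
have mF : nnmeas F by exact: nnmeas_face.
set K := enum (~: I); set L := enum (I :\ i0).
pose al (x : n.-tuple (measurableTypeR R)) := l i0 * (1 - \sum_(i in I :\ i0) a i * crd x i).
pose F1 x := F (upd i0 (al x + l i0 * A * crd x i0) x).
have F1E : F1 = fun x => F (upd i0 (shear a I i0 x) x).
  by apply/funext => z; rewrite /F1 /shear /a invrK.
have mF1 : nnmeas F1.
  rewrite F1E; apply: (nnmeas_comp mF).
  apply: (measurableT_comp (measurable_upd i0) (measurable_fun_pair (measurable_shear a I i0) _)).
  exact: measurable_id.
have pF : pint i0 F = (fun x => ((l i0 * A)%:E * pint i0 F1 x)%E).
  apply/funext => y.
  apply: (@pint_affine _ _ _ (l i0 * A) al _ _ mF); first by rewrite mulr_gt0.
  move=> t z; rewrite /al; congr (_ * (_ - _)); apply: eq_bigr => i.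
  by rewrite !inE => /andP[ii0 _]; rewrite crd_upd (negbTE ii0).
(* Coordinate [i0] goes innermost, so that all others are fixed during the substitution. *)
rewrite (@iint_perm _ _ _ ((K ++ L) ++ [:: i0]))//; last first.
  apply: uniq_perm.
  - exact: enum_uniq.
  - rewrite !cat_uniq !enum_uniq /= andbT orbF; apply/andP; split.
      by apply/hasPn => i; rewrite !mem_enum !inE negbK => /andP[].
    by rewrite mem_cat !mem_enum !inE eqxx i0I.
  - move=> i; rewrite !mem_cat !mem_enum !inE.
    by have [->|] := eqVneq i i0; rewrite ?orbT ?orbF//= orNb.
rewrite iint_cat [iint [:: i0] F]pF iintZl//; last 2 first.
- exact: nnmeas_pint.
- by rewrite lee_fin mulr_ge0 ?ltW.
rewrite -[pint i0 F1]/(iint [:: i0] F1) -iint_cat.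
(* Now the rest of [I] goes innermost: there the cone factor is constant and only the simplex is
   integrated. *)
rewrite (@iint_perm _ _ _ ((i0 :: K) ++ L))//; last first.
  by rewrite -cat1s perm_catC.
rewrite iint_cat.
pose c := \prod_(i in I :\ i0) l i / (#|I| - 1)`!%:R.
have c0 : 0 <= c by rewrite divr_ge0// prodr_ge0// => i _; rewrite ltW.
have sL : size L = (#|I| - 1)%N.
  by rewrite -cardE (cardsD1 i0 I) i0I addnC addnK.
have -> : iint L F1 = fun x => (c%:E * (cone a I i0 rho x)%:E)%E.
  apply/funext => y.
  transitivity (iint L (fun z => (cone a I i0 rho y)%:E *
     (simp a (fun i => crd y i0 * a i) L 1 z)%:E)%E y).
    apply: eq_iint => z yz; rewrite F1E /F face_shear// EFinM.
    have e0 : crd z i0 = crd y i0 by apply: yz; rewrite mem_enum !inE eqxx.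
    rewrite e0 (@eq_cone _ _ _ _ _ _ z y)// => i iI; apply: yz.
    by move: iI; rewrite mem_enum !inE negb_and => ->; rewrite orbT.
  rewrite iintZl; [|exact: nnmeas_simp|by rewrite lee_fin cone_ge0].
  rewrite iint_simp ?enum_uniq// ltr01 mul1r expr1n mul1r sL big_enum /=.
  by rewrite muleC.
rewrite iintZl; [|exact: nnmeas_cone|by rewrite lee_fin].
rewrite muleA -EFinM; congr (_%:E * _)%E.
by rewrite /c (big_setD1 i0 i0I) /=; ring.
Qed.

(** * Gaussian measure of the cones *)

Lemma iint0 (R : realType) n (s : seq 'I_n) (x : n.-tuple (measurableTypeR R)) :
  iint s (fun=> 0%E) x = 0%E.
Proof. by elim: s x => //= i s IH x; apply: integral0_eq => t _; exact: IH. Qed.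

(** An infinite integral would give [Gamma s] the value 0, which its positivity excludes. *)
Lemma ge0_integral_Gamma (R : realType) (s : R) : 1 <= s ->
  (\int[@lebesgue_measure R]_(t in `]0%R, +oo[) (t `^ (s - 1) * expR (- t))%R%:E =
   (Gamma s)%:E)%E.
Proof.
move=> s1; have := Gamma_gt0 s1; rewrite /Gamma /Rintegral.
by case: (integral _ _ _) => //=; rewrite ltxx.
Qed.

Lemma sqrtrX_powR (R : realType) (x : R) (k : nat) : 0 <= x ->
  Num.sqrt x ^+ k = x `^ (k%:R / 2).
Proof.
by move=> x0; rewrite -powR12_sqrt// -powR_mulrn ?powR_ge0// -powRrM mulrC.
Qed.

Lemma cone_scale (R : realType) n (a : 'I_n -> R) (I : {set 'I_n}) i0 (rho u : R) y :
  0 < rho ->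
  cone a I i0 (rho ^+ 2 * u) (scale_on (i0 :: enum (~: I)) rho y) = cone a I i0 u y.
Proof.
move=> rho0.
have e0 : crd (scale_on (i0 :: enum (~: I)) rho y) i0 = rho * crd y i0.
  by rewrite crd_scale_on mem_head.
have e i : i \in ~: I -> crd (scale_on (i0 :: enum (~: I)) rho y) i = rho * crd y i.
  by move=> iI; rewrite crd_scale_on inE mem_enum iI orbT.
rewrite /cone e0; congr (_ * _).
  by apply: eq_bigr => i iI; rewrite e// -mulrA ler_pM2l.
rewrite exprMn -mulrA [X in _ + X <= _](eq_bigr (fun i => rho ^+ 2 * crd y i ^+ 2)) => [|i iI].
  by rewrite -mulr_sumr -mulrDr ler_pM2l// exprn_gt0.
by rewrite e// exprMn.
Qed.

Lemma iint_cone_scale (R : realType) n (a : 'I_n -> R) (I : {set 'I_n}) i0 (rho u : R) x :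
  0 < rho -> i0 \in I ->
  iint (i0 :: enum (~: I)) (fun y => (cone a I i0 (rho ^+ 2 * u) y)%:E) x =
  ((rho ^+ #|~: I|.+1)%:E *
   iint (i0 :: enum (~: I)) (fun y => (cone a I i0 u y)%:E) x)%E.
Proof.
move=> rho0 i0I.
rewrite (@iint_scale _ _ _ rho)//; first last.
- by rewrite /= enum_uniq mem_enum inE i0I.
- exact: nnmeas_cone.
rewrite [size _]/= -cardE; congr (_ * iint _ _ _)%E.
by apply/funext => y; rewrite cone_scale.
Qed.

Lemma cone_lt0 (R : realType) n (a : 'I_n -> R) (I : {set 'I_n}) i0 (rho : R) y :
  rho < 0 -> cone a I i0 rho y = 0.
Proof.
move=> rho0; rewrite /cone leNgt (lt_le_trans rho0) ?mulr0// addr_ge0//.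
  by rewrite mulr_ge0 ?sqr_ge0// sumr_ge0// => i _; rewrite sqr_ge0.
by rewrite sumr_ge0// => i _; rewrite sqr_ge0.
Qed.

Definition gauss_cone (R : realType) n (a : 'I_n -> R) (I : {set 'I_n}) (i0 : 'I_n)
    (y : n.-tuple (measurableTypeR R)) : R :=
  \prod_(i in ~: I) (crd y i <= crd y i0 * a i)%R%:R *
  expR (- ((crd y i0 ^+ 2 * (\sum_(i in I) a i ^+ 2) +
     \sum_(i in ~: I) crd y i ^+ 2) / 2)).

Lemma nnmeas_gauss_cone (R : realType) n (a : 'I_n -> R) (I : {set 'I_n}) i0 :
  nnmeas (fun y => (gauss_cone a I i0 y)%:E).
Proof.
have mc i : measurable_fun setT (fun y : n.-tuple (measurableTypeR R) => crd y i).
  exact: measurable_crd.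
apply: nnmeas_EFin => [|x]; last by rewrite mulr_ge0 ?expR_ge0// prodr_ge0.
apply: measurable_funM.
  under eq_fun do rewrite -big_enum /=.
  apply: measurable_prod => i _; apply: measurable_ind_le => //.
  exact: measurable_funM.
apply: measurableT_comp => //; apply: measurableT_comp => //; apply: measurable_funM => //.
apply: measurable_funD.
  by apply: measurable_funM => //; exact: measurable_funX.
under eq_fun do rewrite -big_enum /=.
by apply: measurable_sum => i; exact: measurable_funX.
Qed.

(** The layer-cake formula at half the quadratic form [q]; the condition [q / 2 <= v] turns into the
    bound [2 * v] of the cone. *)
Lemma gauss_cone_layer (R : realType) n (a : 'I_n -> R) (I : {set 'I_n}) i0 y :
  ((gauss_cone a I i0 y)%:E =
   \int[@lebesgue_measure R]_v ((expR (- v))%R%:E * (cone a I i0 (2 * v)%R y)%:E))%E.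
Proof.
rewrite /gauss_cone /cone; set P := \prod_(i in _) _; set q := _ + _.
have P0 : 0 <= P by rewrite prodr_ge0.
rewrite EFinM -integral_expRN_ge -ge0_integralZl//; last first.
  apply/measurable_EFinP; apply: measurable_funM; first exact: measurable_ind_le.
  by apply: measurableT_comp => //; exact: measurable_oppr.
apply: eq_integral => v _; rewrite -!EFinM ler_pdivrMr// (mulrC v); congr EFin; ring.
Qed.

(** By homogeneity the cone volume at [2 * v] is [(2 * v) ^ (d / 2)] times the one at 1, and
    integrating this against [expR (- v)] over positive [v] produces the Gamma value. *)
Lemma iint_gauss_cone_layer (R : realType) n (a : 'I_n -> R) (I : {set 'I_n}) i0 x :
  i0 \in I ->
  (iint (i0 :: enum (~: I)) (fun y => (gauss_cone a I i0 y)%:E) x =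
  (2 `^ (#|~: I|.+1%:R / 2) * Gamma (#|~: I|.+1%:R / 2 + 1))%:E *
   iint (i0 :: enum (~: I)) (fun y => (cone a I i0 1 y)%:E) x)%E.
Proof.
move=> i0I; set s := i0 :: _; set d := #|~: I|.+1.
pose B u := iint s (fun y => (cone a I i0 u y)%:E) x.
have B0 u : (0 <= B u)%E by have [_ ->] := nnmeas_iint s (nnmeas_cone a I i0 u).
have -> : (fun y => (gauss_cone a I i0 y)%:E) = (fun y => \int[@lebesgue_measure R]_v
    ((expR (- v))%R%:E * (cone a I i0 (2 * v)%R y)%:E))%E.
  by apply/funext => y; rewrite gauss_cone_layer.
have BN u : u < 0 -> B u = 0%E.
  move=> u0; rewrite /B -[RHS](iint0 s x); congr (iint s _ x).
  by apply/funext => y; rewrite cone_lt0.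
have me : measurable_fun setT (fun v : R => expR (- v)).
  by apply: measurableT_comp => //; exact: measurable_oppr.
have m2 : measurable_fun setT (fun v : R => 2 * v) by exact: measurable_funM.
have mF : nnmeas (fun p : measurableTypeR R * n.-tuple (measurableTypeR R) =>
    (expR (- p.1))%R%:E * (cone a I i0 (2 * p.1)%R p.2)%:E)%E.
  apply: nnmeasM; apply: nnmeas_EFin => [|p]; rewrite ?expR_ge0 ?cone_ge0//.
    exact: (measurableT_comp me measurable_fst).
  apply: measurable_cone; last exact: measurable_snd.
  exact: (measurableT_comp m2 measurable_fst).
rewrite iint_integral//.
rewrite (eq_integral (fun v : measurableTypeR R => (expR (- v))%R%:E * B (2 * v)%R)%E); last first.
  by move=> v _; rewrite iintZl ?lee_fin ?expR_ge0//; exact: nnmeas_cone.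
rewrite -/(B 1).
transitivity (\int[@lebesgue_measure R]_(v in `[0%R, +oo[) ((expR (- v))%R%:E * B (2 * v)%R))%E.
  rewrite [RHS]integral_mkcond; apply: eq_integral => v _.
  rewrite patchE; case: ifPn => //; rewrite notin_setE /= in_itv /= andbT => /negP.
  rewrite -ltNge => v0.
  by rewrite BN ?mule0// pmulr_rlt0.
have mB : measurable_fun setT (fun v : R => (expR (- v))%R%:E * B (2 * v)%R)%E.
  apply: emeasurable_funM; first exact/measurable_EFinP.
  have mc : nnmeas (fun p : measurableTypeR R * n.-tuple (measurableTypeR R) =>
      (cone a I i0 (2 * p.1) p.2)%:E).
    apply: nnmeas_EFin => [|p]; last exact: cone_ge0.
    apply: measurable_cone; last exact: measurable_snd.
    exact: (measurableT_comp m2 measurable_fst).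
  have [mI _] := @nnmeas_iint_param _ _ _ _ s
    (fun (v : measurableTypeR R) y => (cone a I i0 (2 * v) y)%:E) mc.
  exact: (measurable_fun_pair1 x mI).
(* The endpoint 0 is dropped because the scaling factor [Num.sqrt (2 * v)] has to be positive. *)
rewrite -integral_itv_obnd_cbnd; last exact: measurable_funTS.
transitivity (\int[@lebesgue_measure R]_(v in `]0%R, +oo[)
   (((2 `^ (d%:R / 2))%:E * B 1%R) *
    (v `^ (d%:R / 2 + 1 - 1) * expR (- v))%R%:E))%E.
  apply: eq_integral => v; rewrite inE /= in_itv /= andbT => v0.
  have -> : B (2 * v) = ((Num.sqrt (2 * v) ^+ d)%R%:E * B 1%R)%E.
    rewrite -iint_cone_scale ?sqrtr_gt0 ?mulr_gt0//.
    by rewrite mulr1 sqr_sqrtr// mulr_ge0// ltW.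
  rewrite sqrtrX_powR ?mulr_ge0 ?(ltW v0)// powRM ?(ltW v0)// addrK.
  rewrite muleA -EFinM [RHS]muleAC -EFinM; congr (_%:E * _)%E; ring.
rewrite ge0_integralZl//; last 3 first.
- apply/measurable_EFinP; apply: measurable_funTS.
  by apply: measurable_funM; [exact: measurable_powR|exact: me].
- by move=> v _; rewrite lee_fin mulr_ge0 ?powR_ge0 ?expR_ge0.
- by rewrite mule_ge0 ?lee_fin ?powR_ge0.
rewrite ge0_integral_Gamma; last by rewrite lerDr divr_ge0.
by rewrite muleAC -EFinM.
Qed.

Lemma integral_phi_scale (R : realType) (c : R) : 0 < c ->
  (\int[@lebesgue_measure R]_t (phi (t * c)%R)%:E = (c^-1)%:E)%E.
Proof.
move=> c0; have mphi : measurable_fun setT (@phi R).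
  by rewrite phiE; exact: measurable_normal_pdf.
have p0 (t : R) : 0 <= phi t by rewrite phiE normal_pdf_ge0.
have := @integral_normal_pdf R 0 1; rewrite -phiE.
rewrite (@ge0_integral_affine _ (fun t => (phi t)%:E) 0 c)//; last exact: nnmeas_EFin.
under eq_integral do rewrite add0r mulrC.
(* An infinite value is impossible, since its product with [c] is 1. *)
case: (integral _ _ _) => [r| |] /=.
- rewrite -EFinM => -[cr]; congr EFin; apply: (mulfI (lt0r_neq0 c0)).
  by rewrite cr mulfV// gt_eqF.
- by rewrite gt0_muley ?lte_fin.
- by rewrite gt0_muleNy ?lte_fin.
Qed.

(** For a fixed value [t] of coordinate [i0] the integrand is a product of one-variable Gaussians
    cut off at [t * a i]. Each coordinate, [i0] included, supplies one factor
    [Num.sqrt (2 * pi)]. *)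
Lemma iint_gauss_cone (R : realType) n (a : 'I_n -> R) (I : {set 'I_n}) i0 x :
  (forall i, 0 < a i) -> i0 \in I ->
  iint (i0 :: enum (~: I)) (fun y => (gauss_cone a I i0 y)%:E) x =
  (Num.sqrt (2 * @pi R) ^+ #|~: I|.+1 *
   \int[lebesgue_measure]_t
     (phi (t * Num.sqrt (\sum_(i in I) a i ^+ 2)) * \prod_(i in ~: I) Phi (t * a i)))%:E.
Proof.
move=> a0 i0I; have I0 : I != finset.set0 by apply/finset.set0Pn; exists i0.
set A := \sum_(i in I) _; have A0 : 0 < A by exact: sum_sqr_gt0.
set C := Num.sqrt (2 * pi) ^+ _.
have s0 : 0 < Num.sqrt (2 * pi) :> R by rewrite sqrtr_gt0 mulr_gt0 ?pi_gt0.
have C0 : 0 < C by rewrite exprn_gt0.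
pose g (t : R) := phi (t * Num.sqrt A) * \prod_(i in ~: I) Phi (t * a i).
have p0 (t : R) : 0 <= phi t by rewrite phiE normal_pdf_ge0.
have P01 t : 0 <= \prod_(i in ~: I) Phi (t * a i) <= 1.
  rewrite prodr_ile1 ?andbT => [|i _]; last exact: Phi_ge0_le1.
  by apply: prodr_ge0 => i _; case/andP: (Phi_ge0_le1 (t * a i)).
have g0 t : 0 <= g t by rewrite mulr_ge0//; case/andP: (P01 t).
pose h (t : measurableTypeR R) :=
  iint (enum (~: I)) (fun y => (gauss_cone a I i0 y)%:E) (upd i0 t x).
have [mh h0] : nnmeas h.
  exact: (nnmeas_comp (nnmeas_iint _ (nnmeas_gauss_cone a I i0)) (measurable_upd1 i0 x)).
have hE t : h t = (C * g t)%:E.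
  transitivity (iint (enum (~: I)) (fun y => (expR (- (t ^+ 2 * A / 2)))%:E *
      (\prod_(i <- enum (~: I)) ((crd y i <= t * a i)%R%:R * expR (- crd y i ^+ 2 / 2)))%:E)%E
      (upd i0 t x)).
    apply: eq_iint => y xy; rewrite -EFinM; congr EFin.
    have -> : gauss_cone a I i0 y = \prod_(i in ~: I) (crd y i <= t * a i)%R%:R *
       expR (- ((t ^+ 2 * A + \sum_(i in ~: I) crd y i ^+ 2) / 2)).
      have -> // : t = crd y i0.
      by rewrite /crd xy ?tnth_upd ?eqxx// mem_enum inE i0I.
    rewrite big_enum /= big_split /= mulrCA; congr (_ * _).
    rewrite -expR_sum -expRD; congr expR.
    by rewrite -mulr_suml sumrN; ring.
  rewrite iintZl ?lee_fin ?expR_ge0//; last first.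
    apply: nnmeas_EFin => [|y]; last by rewrite prodr_ge0// => i _; rewrite mulr_ge0 ?expR_ge0.
    apply: measurable_prod => i _; apply: measurable_funM.
      by apply: measurable_ind_le => //; exact: measurable_crd.
    apply: measurableT_comp => //; apply: measurable_funM => //.
    by apply: measurableT_comp => //; apply: measurable_funX; exact: measurable_crd.
  rewrite (@iint_prod _ _ (fun i u => (u <= t * a i)%R%:R * expR (- u ^+ 2 / 2))
    (fun i => Num.sqrt (2 * pi) * Phi (t * a i))) ?enum_uniq//; last 2 first.
  - move=> i; apply: measurable_funM; first exact: measurable_ind_le.
    apply: measurableT_comp => //; apply: measurable_funM => //.
    by apply: measurableT_comp => //; exact: measurable_funX.
  - by move=> i; exact: integral_gauss_le.
  rewrite -EFinM; congr EFin; rewrite big_enum /= big_split /= prodr_const.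
  rewrite /C /g [_ ^+ #|_|.+1]exprS /phi exprMn sqr_sqrtr ?(ltW A0)// mulNr.
  set S := Num.sqrt _ in s0 *; set E := expR _; field; exact: lt0r_neq0.
(* Measurability is read off from [h], of which [g] is a constant multiple. *)
have mg : measurable_fun setT (fun t => (g t)%:E).
  rewrite (_ : (fun t => _) = fun t => ((C^-1)%:E * h t)%E).
    by apply: emeasurable_funM => //; exact: measurable_cst.
  by apply/funext => t; rewrite hE -EFinM mulKf// gt_eqF.
rewrite /= /pint; under eq_integral do rewrite -/(h _) hE EFinM.
rewrite ge0_integralZl ?lee_fin//; last 2 first.
- by move=> t _; rewrite lee_fin.
- exact: ltW.
(* The real-valued integral is the extended one only once finiteness is known; it follows from the
   bound by [phi (t * Num.sqrt A)], the product of the [Phi] being at most 1. *)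
rewrite EFinM /Rintegral fineK// ge0_fin_numE; last first.
  by apply: integral_ge0 => t _; rewrite lee_fin; exact: (g0 t).
apply: (@le_lt_trans _ _ (\int[@lebesgue_measure R]_t (phi (t * Num.sqrt A)%R)%:E)%E).
  apply: ge0_le_integral => //.
  - by move=> t _; rewrite lee_fin; exact: (g0 t).
  - apply/measurable_EFinP; rewrite phiE; apply: measurableT_comp.
      exact: measurable_normal_pdf.
    exact: measurable_funM.
  - by move=> t _; rewrite lee_fin ler_piMr//; case/andP: (P01 t).
by rewrite integral_phi_scale ?sqrtr_gt0// ltry.
Qed.

(** Two evaluations of the Gaussian integral are compared: with [d] the dimension,
    [(2 * pi) ^ (d / 2)] divided by [2 ^ (d / 2) * Gamma (d / 2 + 1)] is [kappa R d]. *)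
Lemma iint_cone1 (R : realType) n (a : 'I_n -> R) (I : {set 'I_n}) i0 x :
  (forall i, 0 < a i) -> i0 \in I ->
  iint (i0 :: enum (~: I)) (fun y => (cone a I i0 1 y)%:E) x =
  (kappa R #|~: I|.+1 *
   \int[lebesgue_measure]_t
     (phi (t * Num.sqrt (\sum_(i in I) a i ^+ 2)) * \prod_(i in ~: I) Phi (t * a i)))%:E.
Proof.
move=> a0 i0I; have := iint_gauss_cone x a0 i0I.
rewrite iint_gauss_cone_layer//; set X := Rintegral _ _ _; set d := #|~: I|.+1.
have G0 : 0 < Gamma (d%:R / 2 + 1) :> R by rewrite Gamma_gt0// lerDr divr_ge0.
have P0 : 0 < 2 `^ (d%:R / 2) :> R by rewrite powR_gt0.
have c0 : 0 < 2 `^ (d%:R / 2) * Gamma (d%:R / 2 + 1) :> R by rewrite mulr_gt0.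
case: (iint _ _ _) => [r| |].
- rewrite -EFinM sqrtrX_powR ?mulr_ge0 ?pi_ge0// powRM ?pi_ge0// => -[E].
  congr EFin; rewrite /kappa.
  have -> : r = (2 `^ (d%:R / 2) * Gamma (d%:R / 2 + 1))^-1 *
     (2 `^ (d%:R / 2) * Gamma (d%:R / 2 + 1) * r) by rewrite mulKf// gt_eqF.
  by rewrite E; field; rewrite !gt_eqF.
- by rewrite gt0_muley ?lte_fin.
- by rewrite gt0_muleNy ?lte_fin.
Qed.

(** Radius 0 is out of reach of the scaling argument. The integrand then lives on the null set where
    coordinate [i0] is 0. *)
Lemma iint_cone0 (R : realType) n (a : 'I_n -> R) (I : {set 'I_n}) i0 x :
  (forall i, 0 < a i) -> i0 \in I ->
  iint (i0 :: enum (~: I)) (fun y => (cone a I i0 0 y)%:E) x = 0%E.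
Proof.
move=> a0 i0I; have I0 : I != finset.set0 by apply/finset.set0Pn; exists i0.
rewrite /= /pint; set h := fun t => _.
transitivity (\int[@lebesgue_measure R]_(t in [set 0%R]) h t)%E; last exact: integral_set1.
rewrite [RHS]integral_mkcond; apply: eq_integral => t _.
rewrite patchE; case: ifPn => //; rewrite notin_setE /= => /eqP t0.
transitivity (0%E : \bar R) => //.
rewrite /h -[RHS](iint0 (enum (~: I)) (upd i0 t x)).
apply: eq_iint => y xy; congr EFin; rewrite /cone.
have -> : crd y i0 = t by rewrite /crd xy ?tnth_upd ?eqxx// mem_enum inE i0I.
rewrite [X in _ * X](_ : _ = 0) ?mulr0// leNgt.
rewrite (_ : 0 < _) // ltr_wpDr//; first by apply: sumr_ge0 => i _; rewrite sqr_ge0.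
by rewrite mulr_gt0 ?sum_sqr_gt0// lt_neqAle sqr_ge0 eq_sym sqrf_eq0 t0.
Qed.

Lemma iint_cone (R : realType) n (a : 'I_n -> R) (I : {set 'I_n}) i0 r x :
  (forall i, 0 < a i) -> i0 \in I -> 0 <= r ->
  iint (i0 :: enum (~: I)) (fun y => (cone a I i0 (r ^+ 2) y)%:E) x =
  (kappa R #|~: I|.+1 * r ^+ #|~: I|.+1 *
   \int[lebesgue_measure]_t
     (phi (t * Num.sqrt (\sum_(i in I) a i ^+ 2)) * \prod_(i in ~: I) Phi (t * a i)))%:E.
Proof.
move=> a0 i0I; rewrite le_eqVlt => /orP[/eqP <-|r0].
  have -> : 0 ^+ 2 = 0 :> R by rewrite expr0n.
  by rewrite iint_cone0// expr0n /= mulr0 mul0r.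
rewrite -[r ^+ 2]mulr1 iint_cone_scale// iint_cone1// -EFinM; congr EFin.
by rewrite mulrCA mulrA.
Qed.

(** * The Steiner formula of the simplex *)

Definition face_coeff (R : realType) n (l : 'I_n -> R) (I : {set 'I_n}) : R :=
  (\prod_(i in I) l i) * (\sum_(i in I) (l i ^+ 2)^-1) *
     \int[lebesgue_measure]_x
       (phi (x * Num.sqrt (\sum_(i in I) (l i ^+ 2)^-1)) *
        \prod_(i in ~: I) Phi (x / l i)).

(** The cone has dimension [#|~: I| + 1 = n - (#|I| - 1)], which assigns the piece to the Steiner
    coefficient of index [#|I| - 1]. *)
Lemma iint_face_coeff (R : realType) n (l : 'I_n -> R) (I : {set 'I_n}) r x :
  (forall i, 0 < l i) -> I != finset.set0 -> 0 <= r ->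
  iint (enum 'I_n) (fun x => (face (fun i => (l i)^-1) I (r ^+ 2) x)%:E) x =
  ((#|I|.-1)`!%:R^-1 * face_coeff l I *
    (kappa R (n - #|I|.-1) * r ^+ (n - #|I|.-1)))%:E.
Proof.
move=> l0 I0 r0; have [i0 i0I] := finset.set0Pn _ I0.
have a0 i : 0 < (l i)^-1 by rewrite invr_gt0.
rewrite (iint_face _ _ l0 i0I) (iint_cone _ a0 i0I r0) -EFinM; congr EFin.
have -> : #|~: I|.+1 = (n - #|I|.-1)%N.
  have aux k c N : (0 < k)%N -> (k + c)%N = N -> c.+1 = (N - k.-1)%N.
    by case: k => // k _ <-; rewrite /= addSnnS addnC addnK.
  by apply: aux; rewrite ?card_gt0// cardsC card_ord.
have -> : \sum_(i in I) (l i)^-1 ^+ 2 = \sum_(i in I) (l i ^+ 2)^-1.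
  by apply: eq_bigr => i _; rewrite exprVn.
by rewrite /face_coeff subn1; set X := Rintegral _ _ _; ring.
Qed.

(** Exactly one region contains [y], and there membership in the parallel body is the bound on
    [sqdist]. *)
Lemma sum_face (R : realType) n (l : 'I_n -> R) r (y : n.-tuple (measurableTypeR R)) :
  (0 < n)%N -> (forall i, 0 < l i) -> 0 <= r ->
  (\1_[set t : n.-tuple (measurableTypeR R) |
    minkowski_sum (conv_hull [set l i *: delta_mx ord0 i | i in [set: 'I_n]])
      (dilate r (@unit_ball R n)) (\row_i tnth t i)] y)%:E =
  (\sum_(I : {set 'I_n}) (face (fun i => (l i)^-1) I (r ^+ 2) y)%:E)%E.
Proof.
move=> n0 l0 r0; have a0 i : 0 < (l i)^-1 by rewrite invr_gt0.
have [I0 rI0] := region_exists (crd y) n0 a0.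
rewrite (bigD1 I0)//= big1 ?adde0 => [|I II0]; last first.
  rewrite /face; case: (boolP (region _ I _)) => [rI|]; last by rewrite mul0r.
  by move: II0; rewrite (region_uniq a0 rI rI0) eqxx.
have e (z : 'I_n -> R) : \sum_i ((\row_i0 tnth y i0) ord0 i - z i) ^+ 2 =
    \sum_i (crd y i - z i) ^+ 2.
  by apply: eq_bigr => i _; rewrite mxE.
rewrite /face rI0 mul1r indicE; congr ((nat_of_bool _)%:R%:E).
apply/idP/idP; rewrite inE /= minkowski_simplex_ball//.
  by move=> [z [z0 sz h]]; apply/(sqdistP _ a0 rI0); exists z; split; rewrite -?e.
by move/(sqdistP _ a0 rI0) => [z [z0 sz h]]; exists z; split; rewrite ?e.
Qed.

Lemma steiner_simplex (R : realType) n (l : 'I_n -> R) :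
  (0 < n)%N -> (forall i, 0 < l i) ->
  steiner_formula (conv_hull [set l i *: delta_mx ord0 i | i in [set: 'I_n]])
    (fun k : 'I_n.+1 => (k`!%:R)^-1 *
       \sum_(I : {set 'I_n} | #|I| == k.+1) face_coeff l I).
Proof.
move=> n0 l0 r r0.
rewrite /Vol (lebesgue_tupleE _ [tuple (0 : R) | i < n]).
under [in LHS]eq_fun do rewrite sum_face//.
rewrite iint_sum => [|I]; last exact: nnmeas_face.
(* The empty set spans no face, and its indicator is 0. *)
rewrite (bigID (fun I => I != finset.set0)) /= [X in (_ + X)%E]big1 ?adde0 => [|I]; last first.
  rewrite negbK => /eqP ->; rewrite -[RHS](iint0 (enum 'I_n) [tuple (0 : R) | i < n]).
  by apply: eq_iint => y _; rewrite /face /region eqxx mul0r.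
rewrite (eq_bigr (fun I : {set 'I_n} => ((#|I|.-1)`!%:R^-1 * face_coeff l I *
    (kappa R (n - #|I|.-1) * r ^+ (n - #|I|.-1)))%:E)) => [|I I0]; last exact: iint_face_coeff.
rewrite sumEFin; congr EFin.
(* The faces are grouped by dimension; [inord] is faithful because [#|I|.-1 <= n]. For [k = n] no
   set has [n + 1] elements and the coefficient is 0. *)
rewrite (partition_big (fun I : {set 'I_n} => inord #|I|.-1 : 'I_n.+1) xpredT)//=.
apply: eq_bigr => k _; rewrite !mulr_sumr mulr_suml.
apply: eq_big => [I|I /andP[I0 /eqP <-]].
  rewrite -card_gt0 -val_eqE /= inordK; last first.
    by rewrite ltnS (leq_trans (leq_pred _))// -[leqRHS]card_ord max_card.
  by case: #|I|.
rewrite inordK; last by rewrite ltnS (leq_trans (leq_pred _))// -[leqRHS]card_ord max_card.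
ring.
Qed.

Theorem theorem3p1 (R : realType) (n : nat) (hn : (1 <= n)%N)
    (l : 'I_n -> R) (hl : forall i, 0 < l i)
    (m : nat) (hm : (1 <= m <= n)%N) :
  let S := conv_hull [set l i *: delta_mx ord0 i | i in [set: 'I_n]] in
  intrinsic_volume S (m - 1) =
  ((m - 1)`!%:R)^-1 *
  \sum_(I : {set 'I_n} | #|I| == m)
    ((\prod_(i in I) l i) * (\sum_(i in I) (l i ^+ 2)^-1) *
     \int[lebesgue_measure]_x
       (phi (x * Num.sqrt (\sum_(i in I) (l i ^+ 2)^-1)) *
        \prod_(i in ~: I) Phi (x / l i))).
Proof.
move=> S; case/andP: hm => m0 mn.
have hS := steiner_simplex hn hl.
(* The coefficients chosen by [xget] satisfy the Steiner formula because some do, and uniqueness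
   identifies them with the explicit ones. *)
rewrite /intrinsic_volume (steiner_formula_unique (xgetPex _ (ex_intro _ _ hS)) hS).
rewrite inordK; last by rewrite ltnS (leq_trans (leq_subr 1 m)).
by rewrite subn1 prednK.
Qed.
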